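(* Under the setup in the context, there is an injective $K$-algebra homomorphism $\Phi\colon \mathcal A\to\mathfrak R_{\mathrm{rk}}$ whose restriction to $\mathcal A_\infty$ is $\pi_\infty$, and such that the sequence $\pi_\infty(\chi_{X\setminus E_n}t)$ converges in $\mathfrak R_{\mathrm{rk}}$ (for the metric $d(x,y)=\mathrm{rk}_{\mathfrak R_{\mathrm{rk}}}(x-y)$) to $\Phi(t)$, which is invertible in $\mathfrak R_{\mathrm{rk}}$. Consequently, the Sylvester matrix rank function $\mathrm{rk}_{\mathcal A}$ on $\mathcal A$ obtained by pulling back (the unique extension to matrices of) $\mathrm{rk}_{\mathfrak R_{\mathrm{rk}}}$ along $\Phi$ is faithful, its restriction $\mathrm{rk}_{\mathcal A_\infty}$ to $\mathcal A_\infty$ is faithful, and $\Phi(\mathcal A_\infty)$ (hence also $\Phi(\mathcal A)$) is dense in $\mathfrak R_{\mathrm{rk}}$; that is, the rank completions of $\mathcal A_\infty$ and of $\mathcal A$ both equal $\mathfrak R_{\mathrm{rk}}$.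
   Context: Let $X$ be an infinite, totally disconnected, compact metrizable space, $T\colon X\to X$ a homeomorphism, and $K$ a field with an involution $\lambda\mapsto\bar\lambda$ (possibly the identity). $C_K(X)$ is the $*$-algebra of locally constant functions $X\to K$ (pointwise operations, $f^*(x)=\overline{f(x)}$); $\chi_U$ denotes the characteristic function of a clopen set $U$. $\mathcal A=C_K(X)\rtimes_T\mathbb Z$ is the algebraic crossed product: finite formal sums $\sum_{i\in\mathbb Z}f_it^i$ with $f_i\in C_K(X)$, componentwise addition, multiplication determined by $tf=(f\circ T^{-1})t$ (so $t\chi_Ut^{-1}=\chi_{T(U)}$), and involution $(ft^i)^*=t^{-i}f^*$; $t$ is invertible with $t^{-1}=t^*$. Let $\mu$ be a full (every nonempty open set has positive measure), ergodic, $T$-invariant Borel probability measure on $X$. A Sylvester matrix rank function on a unital ring $R$ assigns to each matrix $M$ over $R$ a number $\mathrm{rk}(M)\ge0$ such that: $\mathrm{rk}$ of any zero matrix is $0$ and $\mathrm{rk}(1)=1$; $\mathrm{rk}(M_1M_2)\le\min(\mathrm{rk}(M_1),\mathrm{rk}(M_2))$; $\mathrm{rk}\begin{pmatrix}M_1&0\\0&M_2\end{pmatrix}=\mathrm{rk}(M_1)+\mathrm{rk}(M_2)$; $\mathrm{rk}\begin{pmatrix}M_1&M_3\\0&M_2\end{pmatrix}\ge\mathrm{rk}(M_1)+\mathrm{rk}(M_2)$. It is faithful if $\mathrm{rk}(x)=0$ implies $x=0$ for $x\in R$. On a von Neumann regular ring these are the same as pseudo-rank functions (functions $R\to[0,1]$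 with $\mathrm{rk}(0)=0,\mathrm{rk}(1)=1$, $\mathrm{rk}(xy)\le \mathrm{rk}(x),\mathrm{rk}(y)$, additive on orthogonal idempotents), which extend uniquely to matrices. Construction. Fix $y\in X$, a decreasing sequence of clopen sets $E_1\supseteq E_2\supseteq\cdots$ with $\bigcap_nE_n=\{y\}$, and for each $n$ a partition $\mathcal P_n$ of $X\setminus E_n$ (a finite family of nonempty pairwise disjoint clopen sets with union $X\setminus E_n$) such that every member of $\mathcal P_{n+1}\cup\{E_{n+1}\}$ is contained in a member of $\mathcal P_n\cup\{E_n\}$ and $\bigcup_n(\mathcal P_n\cup\{E_n\})$ generates the topology of $X$. Let $\mathcal A_n$ be the unital $*$-subalgebra of $\mathcal A$ generated by $\{\chi_Zt: Z\in\mathcal P_n\}$; then $\mathcal A_n\subseteq\mathcal A_{n+1}$, and $\mathcal A_\infty:=\bigcup_n\mathcal A_n$. Let $\mathcal V_n$ be the set of nonempty sets $W=E_n\cap T^{-1}(Z_1)\cap\cdots\cap T^{-k+1}(Z_{k-1})\cap T^{-k}(E_n)$ with $k\ge1$, $Z_i\in\mathcal P_n$, and put $|W|=k$. With $s_n=\chi_{X\setminus E_n}t$, define $e_{ij}(W)=s_n^i\chi_W(s_n^* )^j$ for $0\le i,j\le|W|-1$ and $h_W=\sum_{l=0}^{|W|-1}\chi_{T^l(W)}$; then $h_W$ is a central projection of $\mathcal A_n$ and $h_W\mathcal A_n\cong M_{|W|}(K)$ via $e_{ij}(W)\mapsto e_{ij}$ (standard matrix units, indexed from $0$; $M_m(K)$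 carries the conjugate-transpose involution). Let $\mathfrak R_n=\prod_{W\in\mathcal V_n}M_{|W|}(K)$ and $\pi_n\colon\mathcal A_n\to\mathfrak R_n$, $\pi_n(a)=(h_Wa)_W$ (an injective $*$-homomorphism). For $W\in\mathcal V_n$, $W'\in\mathcal V_{n+1}$ let $J(W,W')=\{j'\in\{0,\dots,|W'|-1\}: T^{j'}(W')\subseteq W\}$, and let $j_n\colon\mathfrak R_n\to\mathfrak R_{n+1}$ be $j_n((a_W)_W)=\big(\sum_{W}\sum_{j'\in J(W,W')}\sum_{i,j}(a_W)_{ij}\,e_{i+j',j+j'}\big)_{W'}$; these are injective $*$-homomorphisms with $j_n\pi_n=\pi_{n+1}|_{\mathcal A_n}$. Let $\mathfrak R_\infty=\varinjlim(\mathfrak R_n,j_n)$ and $\pi_\infty\colon\mathcal A_\infty\to\mathfrak R_\infty$ the induced injective map. Define the rank function $\mathrm{rk}_{\mathfrak R_n}((x_W)_W)=\sum_{W\in\mathcal V_n}\mu(W)\,\mathrm{Rk}(x_W)$ ($\mathrm{Rk}$ = usual matrix rank); the maps $j_n$ preserve these, giving a faithful rank function $\mathrm{rk}_{\mathfrak R_\infty}$ on the regular ring $\mathfrak R_\infty$. $\mathfrak R_{\mathrm{rk}}$ is the completion of $\mathfrak R_\infty$ with respect to the metric $d(x,y)=\mathrm{rk}_{\mathfrak R_\infty}(x-y)$, a regular ring with the continuous extension $\mathrm{rk}_{\mathfrak R_{\mathrm{rk}}}$ of $\mathrm{rk}_{\mathfrak R_\infty}$. *)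

(* Defs.v *)
From HB Require Import structures.
From mathcomp Require Import all_boot all_order all_algebra.
From mathcomp Require Import all_classical all_reals all_analysis.
From Stdlib Require Import ClassicalEpsilon.
Set Implicit Arguments. Unset Strict Implicit. Unset Printing Implicit Defensive.
Import Order.TTheory GRing.Theory Num.Theory.
Local Open Scope classical_set_scope.
Local Open Scope ring_scope.

Definition borel_set {X : topologicalType} (A : set X) : Prop :=
  smallest (sigma_algebra setT) open A.

Definition borel_probability {R : realType} {X : topologicalType}
    (mu : set X -> R) : Prop :=
  [/\ mu set0 = 0, mu setT = 1,
      (forall A, borel_set A -> 0 <= mu A) &
      (forall F : nat -> set X, (forall n, borel_set (F n)) ->
         trivIset setT F ->
         [sequence \sum_(i < n) mu (F i)]_n @ \oo --> (mu (\bigcup_n F n) : R^o))].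

Definition full_measure {R : realType} {X : topologicalType}
    (mu : set X -> R) : Prop :=
  forall U : set X, open U -> U !=set0 -> 0 < mu U.

Definition invariant_measure {R : realType} {X : topologicalType}
    (T : X -> X) (mu : set X -> R) : Prop :=
  forall A, borel_set A -> mu (T @^-1` A) = mu A.

Definition ergodic_measure {R : realType} {X : topologicalType}
    (T : X -> X) (mu : set X -> R) : Prop :=
  forall A, borel_set A -> T @^-1` A = A -> mu A = 0 \/ mu A = 1.

Definition locally_constant {X : topologicalType} {K : Type} (f : X -> K) :=
  forall x, exists U : set X, [/\ open U, U x & forall z, U z -> f z = f x].

Definition chi {X : Type} {K : nzRingType} (U : set X) (x : X) : K :=
  if asbool (U x) then 1 else 0.

(* An element  sum_i f_i t^i  is encoded by its coefficient function   *)
(* i |-> f_i  :  int -> X -> K.                                         *)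

Section CrossedProduct.
Variables (X : topologicalType) (T Tinv : X -> X) (K : fieldType)
          (conj : K -> K).

Definition cp := int -> X -> K.

Definition Tpow (i : int) : X -> X :=
  match i with Posz n => iter n T | Negz n => iter n.+1 Tinv end.

Definition inA (a : cp) : Prop :=
  (exists N : nat, forall i : int, (N < `|i|)%N -> forall x, a i x = 0) /\
  (forall i, locally_constant (a i)).

Definition cpzero : cp := fun _ _ => 0.
Definition cpone : cp := fun i _ => if i == 0 then 1 else 0.
Definition cpmono (f : X -> K) (k : int) : cp :=
  fun i x => if i == k then f x else 0.
Definition cpt : cp := cpmono (fun _ => 1) 1.
Definition cpadd (a b : cp) : cp := fun i x => a i x + b i x.
Definition cpscale (l : K) (a : cp) : cp := fun i x => l * a i x.

Definition cbnd (a : cp) : nat :=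
  epsilon (inhabits 0%N)
    (fun N => forall i : int, (N < `|i|)%N -> forall x, a i x = 0).

(* (f t^i)(g t^j) = f (g o T^{-i}) t^{i+j} *)
Definition cpmul (a b : cp) : cp := fun k x =>
  \sum_(m < (cbnd a).*2.+1)
     let i : int := (m%:Z - (cbnd a)%:Z)%R in
     a i x * b (k - i) (Tpow (- i) x).

(* involution: (f t^i)^* = t^{-i} f^* = (f^* o T^i) t^{-i} *)
Definition cpstar (a : cp) : cp := fun k x => conj (a (- k) (Tpow (- k) x)).

Definition cppow (a : cp) (k : nat) : cp := iter k (cpmul a) cpone.

Definition cpsum (I : Type) (r : seq I) (F : I -> cp) : cp :=
  foldr (fun i acc => cpadd (F i) acc) cpzero r.

End CrossedProduct.

Section Construction.
Variables (R : realType) (X : pseudoMetricType R) (T Tinv : X -> X)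
          (K : fieldType) (conj : K -> K) (mu : set X -> R)
          (E : nat -> set X) (P : nat -> set (set X)).

Local Notation cp := (cp X K).
Local Notation cpmul := (cpmul T Tinv).
Local Notation cpstar := (cpstar T Tinv conj).

Inductive inAn (n : nat) : cp -> Prop :=
  | An_gen Z : P n Z -> inAn n (cpmono (chi Z) 1)
  | An_genstar Z : P n Z -> inAn n (cpstar (cpmono (chi Z) 1))
  | An_one : inAn n (@cpone X K)
  | An_add a b : inAn n a -> inAn n b -> inAn n (cpadd a b)
  | An_scale l a : inAn n a -> inAn n (cpscale l a)
  | An_mul a b : inAn n a -> inAn n b -> inAn n (cpmul a b).

Definition inAinf (a : cp) : Prop := exists n, inAn n a.

Definition Vcell (n : nat) (W : set X) (k : nat) : Prop :=
  [/\ (1 <= k)%N,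
      (exists Zs : nat -> set X,
         (forall i, (1 <= i < k)%N -> P n (Zs i)) /\
         W = [set x | [/\ E n x,
                         (forall i, (1 <= i < k)%N -> Zs i (iter i T x))
                       & E n (iter k T x)]])
    & W !=set0].

Definition V (n : nat) (W : set X) : Prop := exists k, Vcell n W k.

Definition wlen (n : nat) (W : set X) : nat :=
  if pselect (exists k, Vcell n W k)
  then epsilon (inhabits 0%N) (Vcell n W) else 0%N.

Definition sn (n : nat) : cp := cpmono (chi (~` E n)) 1.

Definition eW (n : nat) (W : set X) (i j : nat) : cp :=
  cpmul (cpmul (cppow T Tinv (sn n) i) (cpmono (chi W) 0))
       (cppow T Tinv (cpstar (sn n)) j).

Definition hW (n : nat) (W : set X) : cp :=
  cpsum (iota 0 (wlen n W)) (fun l => cpmono (chi (iter l T @` W)) 0).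

(* R_n = prod_{W in V_n} M_{|W|}(K)  (components with W not in V_n are
   0 x 0 matrices) *)
Definition Rn (n : nat) := forall W : set X, 'M[K]_(wlen n W).

Definition Rzero n : Rn n := fun W => 0.
Definition Rone n : Rn n := fun W => 1%:M.
Definition Radd n (x y : Rn n) : Rn n := fun W => x W + y W.
Definition Rsub n (x y : Rn n) : Rn n := fun W => x W - y W.
Definition Rmul n (x y : Rn n) : Rn n := fun W => x W *m y W.

Definition pi_rel (n : nat) (a : cp) (x : Rn n) : Prop :=
  forall W, V n W ->
    cpmul (hW n W) a =
    cpsum (enum 'I_(wlen n W)) (fun i =>
      cpsum (enum 'I_(wlen n W)) (fun j => cpscale (x W i j) (eW n W i j))).

Definition emx (k : nat) (p q : nat) : 'M[K]_k :=
  \matrix_(r, c) ((nat_of_ord r == p) && (nat_of_ord c == q))%:R.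

(* j_n : R_n -> R_{n+1}.  For W' in V_{n+1} and j' < |W'|, the W in V_n
   with T^{j'}(W') contained in W is unique when it exists. *)
Definition jn (n : nat) (x : Rn n) : Rn n.+1 := fun W' =>
  \sum_(j' < wlen n.+1 W')
    if pselect (exists W, V n W /\ iter j' T @` W' `<=` W) then
      let W := epsilon (inhabits set0)
                 (fun W => V n W /\ iter j' T @` W' `<=` W) in
      \sum_(i < wlen n W) \sum_(j < wlen n W)
         x W i j *: emx (wlen n.+1 W') (i + j') (j + j')
    else 0.

Fixpoint jup (n d : nat) (x : Rn n) : Rn (d + n) :=
  match d return Rn (d + n) with
  | 0%N => x
  | d'.+1 => @jn (d' + n) (@jup n d' x)
  end.

Definition rkn (n : nat) (x : Rn n) : \bar R :=
  \esum_(W in V n) ((mu W * (\rank (x W))%:R)%:E).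

(* Elements of R_rk are represented by sequences u with u m in R_m which
   are Cauchy for the rank metric (u m viewed in R_infinity at level m);
   two such sequences represent the same element iff their distance
   tends to 0. *)
Definition Rseq := forall m, Rn m.

Definition rk_cauchy (u : Rseq) : Prop :=
  forall e : R, 0 < e -> exists N, forall p, (N <= p)%N -> forall d : nat,
    (rkn (Rsub (@jup p d (u p)) (u (d + p)%N)) < e%:E)%E.

Definition rk_null (u : Rseq) : Prop :=
  forall e : R, 0 < e -> exists M, forall m, (M <= m)%N -> (rkn (u m) < e%:E)%E.

Definition Req (u v : Rseq) : Prop := rk_null (fun m => Rsub (u m) (v m)).

Definition RRadd (u v : Rseq) : Rseq := fun m => Radd (u m) (v m).
Definition RRmul (u v : Rseq) : Rseq := fun m => Rmul (u m) (v m).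
Definition RRscale (l : K) (u : Rseq) : Rseq := fun m W => l *: u m W.
Definition RRone : Rseq := fun m => Rone m.

Definition castR (a b : nat) (e : a = b) (x : Rn a) : Rn b :=
  match e in _ = b' return Rn b' with erefl => x end.

Definition embed (n : nat) (x : Rn n) : Rseq := fun m =>
  (if (n <= m)%N as b return (n <= m)%N = b -> Rn m
   then fun h => castR (subnK h) (@jup n (m - n) x)
   else fun _ => Rzero m) (erefl _).

End Construction.

(* Main.v *)
(** For [a = sum_i f_i t^i] and a tower over [W] of level [m], let [Phi a m W]
    be the compression of [a] to that tower: its [(p, q)] entry is the value of
    [f_(p-q)] at [T^p x], for a point [x] of [W].  If [a] lies in [A_n] it
    preserves the towers of level [m >= n], so [Phi a m] is exactly the image of
    [pi_n a].  In general all the identities defining a homomorphism, and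
    compatibility with the connecting maps for [m] large, hold except on the rows
    [p] such that [T^p x] is within [N] steps of [E_m], where [N] bounds the
    support of [a].  A matrix has rank at most its number of nonzero rows, so the
    total rank of the error is at most the measure of this neighbourhood of [E_m],
    which tends to that of [y], namely 0.

    For faithfulness, pick [f_i] nonzero on a clopen set [U] disjoint from its
    first iterates (periodic points are negligible).  Keeping the rows in [U] and
    the columns shifted by [i] leaves a diagonal matrix with nonzero diagonal,
    so the rank of [Phi a m] is at least [mu U] up to a boundary term, because the
    towers cover almost all of [X] (Poincare recurrence and ergodicity).  For
    density, a Cauchy sequence is within [e] of some level [n], and an element of
    [R_n] cut down to finitely many towers comes from [A_n]. *)

Require Import Defs.
From HB Require Import structures.
From mathcomp Require Import all_boot all_order all_algebra.
From mathcomp Require Import all_classical all_reals all_analysis.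
From mathcomp Require Import zify lra.
From Stdlib Require Import ClassicalEpsilon.
Set Implicit Arguments.
Unset Strict Implicit.
Unset Printing Implicit Defensive.
Import Order.TTheory GRing.Theory Num.Theory.
Import numFieldNormedType.Exports.
Local Open Scope classical_set_scope.
Local Open Scope ring_scope.

(** * Topology and Borel probabilities *)

Lemma set_mem_cons (I : eqType) (i : I) (s : seq I) :
  [set` i :: s] = [set i] `|` [set` s].
Proof.
apply/seteqP; split=> x /=; rewrite in_cons.
  by case/orP => [/eqP|]; [left|right].
by case=> [->|->]; rewrite ?eqxx ?orbT.
Qed.

Section Topology.
Variable X : topologicalType.

(** Otherwise the complements of the [G n] generate a proper filter. A cluster point of it lies in
    some open [G n], which is disjoint from its own complement. *)
Lemma compact_increasing_cover (G : nat -> set X) :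
  compact [set: X] -> (forall n, open (G n)) ->
  (forall n m, (n <= m)%N -> G n `<=` G m) ->
  (forall x, exists n, G n x) -> exists n, forall x, G n x.
Proof.
move=> cX oG mG cG; apply: contrapT => nG.
have nGn n : ~` G n !=set0.
  apply/set0P/eqP => h; apply: nG; exists n => x; apply: contrapT => nx.
  by have : (~` G n) x by []; rewrite h.
pose F : set_system X := [set A | exists n, ~` G n `<=` A].
have FF : ProperFilter F.
  split; first by move=> [n]; case: (nGn n) => x nx /(_ x nx).
  split; first by exists 0%N.
    move=> A B [n nA] [m mB]; exists (maxn n m) => x nx; split.
      by apply: nA => Gx; apply: nx; apply: mG Gx; rewrite leq_maxl.
    by apply: mB => Gx; apply: nx; apply: mG Gx; rewrite leq_maxr.
  by move=> A B AB [n nA]; exists n => x /nA /AB.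
case: (cX F FF); first by exists 0%N.
move=> x [_ clx]; case: (cG x) => n Gx.
have [] := clx (~` G n) (G n); first by exists n.
  exact: open_nbhs_nbhs.
by move=> z [].
Qed.

Lemma clopen_preimage (Y : topologicalType) (f : X -> Y) (A : set Y) :
  continuous f -> clopen A -> clopen (f @^-1` A).
Proof.
move=> cf [oA cA]; split.
  exact: (proj1 (continuousP f) cf).
exact: (proj1 (continuous_closedP f) cf).
Qed.

Lemma continuous_iter (f : X -> X) n : continuous f -> continuous (iter n f).
Proof.
move=> cf; elim: n => [|n IH] x /=; first exact: cvg_id.
by apply: continuous_comp; [exact: IH|exact: cf].
Qed.

End Topology.

Section BorelSets.
Variable X : topologicalType.
Implicit Types A B : set X.

Lemma borel_setC A : borel_set A -> borel_set (~` A).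
Proof.
move=> bA S sS; rewrite -setTD.
by case: (sS) => -[_ h _] _; apply: h; apply: bA.
Qed.

Lemma borel_bigcup (F : nat -> set X) :
  (forall n, borel_set (F n)) -> borel_set (\bigcup_n F n).
Proof. by move=> bF S sS; case: (sS) => -[_ _ h] _; apply: h => n; apply: bF. Qed.

Lemma borel_open A : open A -> borel_set A.
Proof. by move=> oA S [_]; apply. Qed.

Lemma borel_closed A : closed A -> borel_set A.
Proof. by move=> cA; rewrite -[A]setCK; apply: borel_setC; apply: borel_open; exact: closed_openC. Qed.

Lemma borel_clopen A : clopen A -> borel_set A.
Proof. by case=> oA _; exact: borel_open. Qed.

Lemma borel_set0 : borel_set (@set0 X).
Proof. by apply: borel_open; exact: open0. Qed.

Lemma borel_setT : borel_set [set: X].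
Proof. by apply: borel_open; exact: openT. Qed.

Lemma borel_setU A B : borel_set A -> borel_set B -> borel_set (A `|` B).
Proof.
move=> bA bB; rewrite -bigcup2E; apply: borel_bigcup => n.
by case: n => [|[|n]] //=; exact: borel_set0.
Qed.

Lemma borel_setI A B : borel_set A -> borel_set B -> borel_set (A `&` B).
Proof.
move=> bA bB; rewrite -[_ `&` _]setCK setCI.
by apply: borel_setC; apply: borel_setU; exact: borel_setC.
Qed.

Lemma borel_setD A B : borel_set A -> borel_set B -> borel_set (A `\` B).
Proof. by move=> bA bB; rewrite setDE; apply: borel_setI => //; exact: borel_setC. Qed.

Lemma borel_bigcap (F : nat -> set X) :
  (forall n, borel_set (F n)) -> borel_set (\bigcap_n F n).
Proof.
move=> bF; rewrite -[bigcap _ _]setCK setC_bigcap.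
by apply: borel_setC; apply: borel_bigcup => n; exact: borel_setC.
Qed.

Lemma borel_bigcup_seq (I : eqType) (s : seq I) (F : I -> set X) :
  (forall i, i \in s -> borel_set (F i)) ->
  borel_set (\bigcup_(i in [set` s]) F i).
Proof.
elim: s => [|i s IH] bF.
  by rewrite set_nil bigcup_set0; exact: borel_set0.
rewrite set_mem_cons bigcup_setU bigcup_set1; apply: borel_setU.
  by apply: bF; rewrite mem_head.
by apply: IH => j js; apply: bF; rewrite in_cons js orbT.
Qed.

(** The sets whose preimage is Borel form a sigma-algebra containing the open sets. *)
Lemma borel_preimage (f : X -> X) A :
  continuous f -> borel_set A -> borel_set (f @^-1` A).
Proof.
move=> cf bA; apply: (bA [set B | borel_set (f @^-1` B)]); split.
  split => /=.
  - by rewrite preimage_set0; exact: borel_set0.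
  - by move=> B bB; rewrite setTD preimage_setC; exact: borel_setC.
  - by move=> F bF; rewrite preimage_bigcup; exact: borel_bigcup.
move=> B oB /=; apply: borel_open; exact: (proj1 (continuousP f) cf).
Qed.

End BorelSets.

(** * Finite additivity and continuity along monotone sequences *)

Section BorelProbability.
Variables (R : realType) (X : topologicalType) (mu : set X -> R).
Hypothesis mu_prob : borel_probability mu.
Implicit Types A B : set X.

Let mu0 : mu set0 = 0. Proof. by case: mu_prob. Qed.
Let muT : mu setT = 1. Proof. by case: mu_prob. Qed.

Lemma prob_ge0 A : borel_set A -> 0 <= mu A.
Proof. by case: mu_prob => _ _ h _; exact: h. Qed.

(** Countable additivity is applied to [A], [B], [set0], [set0], and so on: the partial sums are
    constant from index 2 on, and limits are unique. *)
Lemma probU A B : borel_set A -> borel_set B -> A `&` B = set0 ->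
  mu (A `|` B) = mu A + mu B.
Proof.
move=> bA bB AB; case: mu_prob => _ _ _ /(_ (bigcup2 A B)); rewrite bigcup2E => c1.
have bF n : borel_set (bigcup2 A B n) by case: n => [|[|n]] //=; exact: borel_set0.
have tF : trivIset setT (bigcup2 A B).
  apply/trivIsetP => i j _ _; wlog : i j / (i < j)%N => [hw ij|].
    by case: (ltngtP i j) ij => // lij _; [|rewrite setIC]; apply: hw => //;
      rewrite ltn_eqF.
  by case: i => [|[|i]]; case: j => [|[|j]] //= _ _; rewrite ?setI0 ?set0I.
have c2 : [sequence \sum_(i < n) mu (bigcup2 A B i)]_n @ \oo --> (mu A + mu B : R^o).
  apply: cvg_near_cst; exists 2%N => // n /= n2.
  case: n n2 => [|[|n]] // _; rewrite 2!big_ord_recl big1 ?addr0 //=.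
exact: (cvg_unique (@norm_hausdorff _ R^o) (c1 bF tF) c2).
Qed.

Lemma prob_le A B : borel_set A -> borel_set B -> A `<=` B -> mu A <= mu B.
Proof.
move=> bA bB AB; rewrite -(setDUK AB) probU ?setIDK //.
- by rewrite lerDl; by apply: prob_ge0; exact: borel_setD.
- exact: borel_setD.
- by rewrite setDE setICA setICr setI0.
Qed.

Lemma probU_le A B : borel_set A -> borel_set B -> mu (A `|` B) <= mu A + mu B.
Proof.
move=> bA bB; have -> : A `|` B = A `|` (B `\` A).
  by apply/seteqP; split=> x; rewrite /setD /=; case: (pselect (A x)); tauto.
rewrite probU ?lerD2l //; first by apply: prob_le => //; exact: borel_setD.
- exact: borel_setD.
- by rewrite setDE setICA setICr setI0.
Qed.

Lemma probC A : borel_set A -> mu (~` A) = 1 - mu A.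
Proof.
move=> bA; rewrite -muT -(setUv A) probU ?setICr //; last exact: borel_setC.
by rewrite addrAC subrr add0r.
Qed.

Lemma prob_le1 A : borel_set A -> mu A <= 1.
Proof. by move=> bA; rewrite -muT; apply: prob_le => //; exact: borel_setT. Qed.

Lemma prob_sum (I : eqType) (s : seq I) (F : I -> set X) :
  uniq s -> (forall i, i \in s -> borel_set (F i)) ->
  (forall i j x, i \in s -> j \in s -> F i x -> F j x -> i = j) ->
  \sum_(i <- s) mu (F i) = mu (\bigcup_(i in [set` s]) F i).
Proof.
elim: s => [_ _ _|i s IH /= /andP[iNs us] bF dF].
  by rewrite big_nil set_nil bigcup_set0 mu0.
rewrite big_cons set_mem_cons bigcup_setU bigcup_set1 probU.
- rewrite IH // => [j js|j k x js ks]; first by apply: bF; rewrite in_cons js orbT.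
  by apply: dF; rewrite in_cons ?js ?ks orbT.
- by apply: bF; rewrite mem_head.
- by apply: borel_bigcup_seq => j js; apply: bF; rewrite in_cons js orbT.
- apply/seteqP; split=> // x [Fi [j /= js Fj]].
  by move: iNs; rewrite (dF i j x) ?js ?mem_head // in_cons js orbT.
Qed.

Lemma prob_bigcup_le (I : eqType) (s : seq I) (F : I -> set X) :
  (forall i, i \in s -> borel_set (F i)) ->
  mu (\bigcup_(i in [set` s]) F i) <= \sum_(i <- s) mu (F i).
Proof.
elim: s => [_|i s IH bF]; first by rewrite big_nil set_nil bigcup_set0 mu0.
have bF' j : j \in s -> borel_set (F j) by move=> js; apply: bF; rewrite in_cons js orbT.
rewrite big_cons set_mem_cons bigcup_setU bigcup_set1.
apply: le_trans (probU_le _ _) _.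
- by apply: bF; rewrite mem_head.
- exact: borel_bigcup_seq.
- by rewrite lerD2l IH.
Qed.

(** The successive differences [seqD F] are disjoint with the same union, and their partial sums
    telescope to [mu (F n)]. *)
Lemma prob_increasing (F : nat -> set X) (e : R) :
  (forall n, borel_set (F n)) -> (forall n m, (n <= m)%N -> F n `<=` F m) ->
  0 < e -> exists N, forall n, (N <= n)%N -> mu (\bigcup_n F n) - e < mu (F n).
Proof.
move=> bF mF e0; have ndF : nondecreasing_seq F.
  by move=> n m nm; apply/subsetPset; exact: mF.
have bD n : borel_set (seqD F n) by case: n => [|n] //=; exact: borel_setD.
have sE n : \sum_(i < n.+1) mu (seqD F i) = mu (F n).
  elim: n => [|n IH]; first by rewrite big_ord_recl big_ord0 addr0.
  rewrite big_ord_recr /= IH [in RHS](setU_seqD ndF) probU //.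
  by rewrite /= setDE setICA setICr setI0.
case: mu_prob => _ _ _ /(_ _ bD (trivIset_seqD ndF)).
rewrite eq_bigcup_seqD => /cvgrPdist_lt /(_ e e0) [N _ hN].
exists N => n Nn; have := hN n.+1 (leqW Nn); rewrite /= sE.
by rewrite ltr_norml => /andP[_]; lra.
Qed.

Lemma prob_decreasing (F : nat -> set X) (e : R) :
  (forall n, borel_set (F n)) -> (forall n m, (n <= m)%N -> F m `<=` F n) ->
  0 < e -> exists N, forall n, (N <= n)%N -> mu (F n) < mu (\bigcap_n F n) + e.
Proof.
move=> bF mF e0; have [||N hN] := @prob_increasing (fun n => ~` F n) e _ _ e0.
- by move=> n; exact: borel_setC.
- by move=> n m nm; apply: subsetC; exact: mF.
exists N => n /hN; rewrite -setC_bigcap !probC //; last exact: borel_bigcap.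
by lra.
Qed.

End BorelProbability.

(** * Recurrence and periodic points *)

Lemma clopen_exists_lt (X : topologicalType) (F : nat -> set X) m :
  (forall i, clopen (F i)) -> clopen [set z | exists2 i, (i < m)%N & F i z].
Proof.
move=> cF; elim: m => [|m IH].
  rewrite (_ : mkset _ = set0); first exact: clopen0.
  by apply/seteqP; split=> x // [].
rewrite (_ : mkset _ = [set z | exists2 i, (i < m)%N & F i z] `|` F m).
  exact: clopenU.
apply/seteqP; split=> x /=.
  by move=> [i]; rewrite ltnS leq_eqVlt => /orP[/eqP->|im Fi]; [right|left; exists i].
by move=> [[i im Fi]|Fm]; [exists i => //; exact: leqW|exists m].
Qed.

Lemma clopen_forall_lt (X : topologicalType) (F : nat -> set X) m :
  (forall i, clopen (F i)) -> clopen [set z | forall i, (i < m)%N -> F i z].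
Proof.
move=> cF; rewrite (_ : mkset _ = ~` [set z | exists2 i, (i < m)%N & (~` F i) z]).
  apply: (clopenC set0); apply: (@clopen_exists_lt _ (fun i => ~` F i)) => i.
  exact: (clopenC set0).
apply/seteqP; split=> x /=; first by move=> h [i im]; apply; exact: h.
by move=> h i im; apply: contrapT => nF; apply: h; exists i.
Qed.

Section HittingTimes.
Variables (R : realType) (X : topologicalType) (mu : set X -> R) (S : X -> X).
Hypotheses (mu_prob : borel_probability mu) (cS : continuous S)
  (inv_mu : invariant_measure S mu) (erg_mu : ergodic_measure S mu).

Lemma invariant_iter n A : borel_set A -> mu (iter n S @^-1` A) = mu A.
Proof.
move=> bA; elim: n => [//|n IH]; rewrite -IH.
have -> : iter n.+1 S @^-1` A = S @^-1` (iter n S @^-1` A).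
  by apply/seteqP; split=> x /=; rewrite -iterSr.
by apply: inv_mu; apply: borel_preimage => //; exact: continuous_iter.
Qed.

Lemma hitting_set_full E : borel_set E -> 0 < mu E ->
  mu (\bigcup_j (iter j.+1 S @^-1` E)) = 1.
Proof.
move=> bE E0; pose F := \bigcup_j (iter j.+1 S @^-1` E).
have bSE n A : borel_set A -> borel_set (iter n S @^-1` A).
  by move=> bA; apply: borel_preimage => //; exact: continuous_iter.
have bF : borel_set F by apply: borel_bigcup => j; exact: bSE.
have FS n x : F (iter n S x) -> F x.
  by move=> [j _ /=]; rewrite -iterD => Ej; exists (j + n)%N.
(* [F] contains its preimage, of the same measure, so it has the measure of the
   invariant set [D]. *)
pose D := \bigcap_n (iter n S @^-1` F).
have bD : borel_set D by apply: borel_bigcap => n; exact: bSE.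
have DF : mu F <= mu D.
  rewrite leNgt; apply/negP => lt; pose e := mu F - mu D.
  have e0 : 0 < e by rewrite subr_gt0.
  have [|||N /(_ N (leqnn _))] := @prob_decreasing _ _ mu mu_prob (fun n => iter n S @^-1` F) e.
  - by move=> n; exact: bSE.
  - by move=> n m nm x /=; rewrite -(subnK nm) iterD => /FS.
  - exact: e0.
  - by rewrite invariant_iter // /e; lra.
have F0 : 0 < mu F.
  apply: lt_le_trans E0 _; rewrite -(inv_mu bE); apply: prob_le => //.
    exact: (bSE 1%N).
  by move=> x Ex; exists 0%N.
have D1 : mu D = 1.
  case: (erg_mu bD) => // [|D0]; last by move: DF F0; rewrite D0; lra.
  apply/seteqP; split=> x Dx n _ /=.
    by apply: (FS 1%N); have := Dx n I; rewrite /= -iterSr.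
  by have := Dx n.+1 I; rewrite /= -iterSr.
apply/eqP; rewrite eq_le -{2}D1; apply/andP; split; first exact: prob_le1.
by apply: prob_le => // x /(_ 0%N I).
Qed.

(** Continuity from below truncates the hitting time; the uniform bound [L] later bounds the heights
    of towers. *)
Lemma hitting_set_lt E e : borel_set E -> 0 < mu E -> 0 < e ->
  exists L, 1 - e < mu [set x | exists2 j, (j < L)%N & E (iter j.+1 S x)].
Proof.
move=> bE E0 e0.
have bj j : borel_set (iter j.+1 S @^-1` E).
  by apply: borel_preimage => //; exact: continuous_iter.
have [||//|N /(_ N (leqnn _))] := @prob_increasing _ _ mu mu_prob
  (fun L => \bigcup_(j in [set` iota 0 L]) (iter j.+1 S @^-1` E)) e.
- by move=> n; exact: borel_bigcup_seq.
- by move=> n m nm x [j /=]; rewrite mem_iota => jn Ej; exists j => //=;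
    rewrite mem_iota; lia.
move=> h; exists N; move: h.
congr (_ - _ < mu _).
  rewrite -(hitting_set_full bE E0); congr (mu _); apply/seteqP; split=> x.
    by move=> [L _ [j _ Ej]]; exists j.
  by move=> [j _ Ej]; exists j.+1 => //; exists j => //; rewrite /mkset mem_iota; lia.
apply/seteqP; split=> x /=; first by move=> [j /=]; rewrite mem_iota => jn; exists j.
by move=> [j jn Ej]; exists j => //=; rewrite mem_iota.
Qed.

End HittingTimes.

(** * Periodic points and single points are null *)

Section PeriodicPoints.
Variables (R : realType) (X : topologicalType) (mu : set X -> R) (T Tinv : X -> X).
Hypotheses (hX : hausdorff_space X) (infX : infinite_set [set: X])
  (clopen_basis : forall (U : set X) x, open U -> U x ->
     exists C, [/\ clopen C, C x & C `<=` U])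
  (cT : continuous T) (TK : cancel T Tinv) (TinvK : cancel Tinv T)
  (mu_prob : borel_probability mu) (full_mu : full_measure mu)
  (inv_mu : invariant_measure T mu) (erg_mu : ergodic_measure T mu).

Lemma iter_inj n x y : iter n T x = iter n T y -> x = y.
Proof. by elim: n => //= n IH /(can_inj TK). Qed.

Lemma separated_nbhd (x z : X) : x <> z ->
  exists A B : set X, [/\ open A, open B, A x, B z & forall w, A w -> B w -> False].
Proof.
move: hX; rewrite open_hausdorff => h /eqP /h [[A B] /= [Ax Bz] [oA oB /eqP AB]].
exists A, B; split; [by []|by []|exact: set_mem|exact: set_mem|] => w Aw Bw.
by have : (A `&` B) w by []; rewrite AB.
Qed.

Lemma moved_nbhd n x : iter n T x <> x ->
  exists U, [/\ open U, U x & forall z, U z -> ~ U (iter n T z)].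
Proof.
move=> /separated_nbhd [A [B [oA oB Ax Bx AB]]].
exists (iter n T @^-1` A `&` B); split=> //.
  by apply: openI => //; exact: (proj1 (continuousP _) (continuous_iter cT) _ oA).
by move=> z [Az Bz] [_ Bz']; exact: (AB (iter n T z)).
Qed.

Lemma closed_periodic n : closed [set x | iter n T x = x].
Proof.
rewrite -openC openE => x /= nx; have [U [oU Ux hU]] := moved_nbhd nx.
rewrite /interior nbhsE; exists U; first by split.
by move=> z Uz /= e; apply: (hU z Uz); rewrite e.
Qed.

Lemma iter_mul_period n x k : iter n T x = x -> iter (k * n) T x = x.
Proof. by move=> e; elim: k => // k IH; rewrite mulSn iterD IH. Qed.

(** The set is closed and invariant, so ergodicity gives it measure 0 or 1. In the second case
    fullness makes its open complement empty, so that [iter n T] is the identity and every orbit is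
    finite. As [X] is infinite, some point lies off a given orbit, and a small clopen neighbourhood
    of it saturates to an invariant set of measure strictly between 0 and 1. *)
Lemma periodic_null n : (0 < n)%N -> mu [set x | iter n T x = x] = 0.
Proof.
move=> n0; have cF := @closed_periodic n; have bF := borel_closed cF.
have TF : T @^-1` [set x | iter n T x = x] = [set x | iter n T x = x].
  apply/seteqP; split=> x /=; rewrite -iterSr /=; last by move=> ->.
  by move/(can_inj TK).
case: (erg_mu bF TF) => // F1; exfalso.
have per x : iter n T x = x.
  apply: contrapT => nx.
  have := full_mu (closed_openC cF) (ex_intro _ x nx).
  by rewrite probC // F1 subrr ltxx.
have [x0 _] : [set: X] !=set0.
  by apply/set0P/eqP => e; apply: infX; rewrite e; exact: finite_set0.
pose Orb := [set iter i T x0 | i in `I_n].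
have [x nOx] : exists x, ~ Orb x.
  apply: contrapT => h; apply: infX; apply: (@sub_finite_set _ _ Orb).
    by move=> x _; apply: contrapT => nx; apply: h; exists x.
  by apply: finite_image; exact: finite_II.
have x0O k : Orb (iter k T x0).
  exists (k %% n)%N; first by rewrite /= ltn_mod.
  by rewrite [in RHS](divn_eq k n) addnC iterD iter_mul_period.
(* The orbit of [x0] has at most [n] points, so finitely many separations produce a clopen
   neighbourhood of [x] that avoids it. *)
have [C [cC Cx CO]] : exists C, [/\ clopen C, C x & forall k, ~ C (iter k T x0)].
  have : forall m, exists C, [/\ clopen C, C x & forall k, (k < m)%N -> ~ C (iter k T x0)].
    elim=> [|m [C [cC Cx hC]]]; first by exists setT; split=> //; exact: clopenT.
    have [A [B [oA oB Ax Bz AB]]] : exists A B : set X, [/\ open A, open B, A x,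
        B (iter m T x0) & forall w, A w -> B w -> False].
      by apply: separated_nbhd => e; apply: nOx; rewrite e.
    have [C' [cC' C'x C'A]] := clopen_basis oA Ax.
    exists (C `&` C'); split=> //; first exact: clopenI.
    move=> k; rewrite ltnS leq_eqVlt => /orP[/eqP->|km] [Ck C'k].
      exact: (AB _ (C'A _ C'k)).
    exact: (hC k km).
  move=> /(_ n) [C [cC Cx hC]]; exists C; split=> // k.
  by case: (x0O k) => i /= /hC + <-.
(* The saturation of [C]: [n] preimages are enough because [iter n T] is the identity. *)
pose A := [set z | exists2 i, (i < n)%N & C (iter i T z)].
have cA : clopen A.
  apply: clopen_exists_lt => i; apply: clopen_preimage => //; exact: continuous_iter.
have AE z : A z <-> exists k, C (iter k T z).
  split=> [[i _ Ci]|[k Ck]]; first by exists i.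
  exists (k %% n)%N; first by rewrite ltn_mod.
  by move: Ck; rewrite [X in iter X](divn_eq k n) addnC iterD iter_mul_period.
have TA : T @^-1` A = A.
  apply/seteqP; split=> z /AE [k Ck]; apply/AE.
    by exists k.+1; rewrite iterSr.
  (* One step backwards is [n - 1] steps forwards. *)
  by exists (k + n).-1; rewrite -iterSr prednK ?addn_gt0 ?n0 ?orbT // iterD per.
have bA := borel_clopen cA.
have A0 : 0 < mu A by apply: full_mu; [case: cA|exists x; apply/AE; exists 0%N].
have NA0 : 0 < mu (~` A).
  apply: full_mu; first by case: (clopenC set0 cA).
  by exists x0 => /AE [k]; exact: CO.
by move: A0 NA0; rewrite probC //; case: (erg_mu bA TA) => ->; lra.
Qed.

(** The points of period at most [N] form a null set, which cannot contain an open set of positive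
    measure. *)
Lemma aperiodic_point N U : open U -> U !=set0 ->
  exists2 x, U x & forall j, (0 < j <= N)%N -> iter j T x <> x.
Proof.
move=> oU U0; apply: contrapT => h.
have bF j : borel_set [set x | iter j T x = x].
  by apply: borel_closed; exact: closed_periodic.
have := full_mu oU U0; apply/negP; rewrite -leNgt.
pose F j := [set x | iter j T x = x].
have <- : \sum_(j <- iota 1 N) mu (F j) = 0.
  rewrite big_seq big1 // => j; rewrite mem_iota => /andP[j0 _].
  exact: periodic_null.
apply: le_trans (prob_bigcup_le mu_prob _); last by move=> j _; exact: bF.
apply: prob_le => //; first exact: borel_open.
  by apply: borel_bigcup_seq => j _; exact: bF.
move=> x Ux; apply: contrapT => nx; apply: h; exists x => // j jN e; apply: nx.
by exists j => //=; rewrite mem_iota; lia.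
Qed.

(** A periodic [y] lies in a null set of periodic points. Otherwise the iterates of [y] are distinct
    and have equal mass, so [n] times this mass is at most 1 for every [n]. This makes [mu (E n)]
    tend to 0. *)
Lemma singleton_null y : mu [set y] = 0.
Proof.
have b1 (z : X) : borel_set [set z].
  apply: borel_closed; exact: (accessible_closed_set1 (hausdorff_accessible hX)).
case: (pselect (exists2 n, (0 < n)%N & iter n T y = y)) => [[n n0 ny]|aper].
  apply/eqP; rewrite eq_le prob_ge0 // andbT -(periodic_null n0).
  by apply: prob_le => //; [apply: borel_closed; exact: closed_periodic|move=> _ ->].
have yi i : mu [set iter i T y] = mu [set y].
  rewrite -(invariant_iter cT inv_mu i (b1 _)); congr (mu _).
  by apply/seteqP; split=> [x /= /iter_inj|_ ->].
apply/eqP; rewrite eq_le prob_ge0 // andbT leNgt; apply/negP => y0.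
have key n : n%:R * mu [set y] <= 1.
  have dis i j x : i \in iota 0 n -> j \in iota 0 n ->
      [set iter i T y] x -> [set iter j T y] x -> i = j.
    move=> _ _ -> /=; wlog: i j / (i <= j)%N => [hw e|ij].
      by case: (leqP i j) => [|/ltnW] /hw; [exact|move=> /(_ (esym e))].
    rewrite -(subnKC ij) iterD => /iter_inj e.
    case: (posnP (j - i)%N) => [|ji]; first by lia.
    by exfalso; apply: aper; exists (j - i)%N.
  have := prob_sum mu_prob (iota_uniq 0 n) (fun i _ => b1 (iter i T y)) dis.
  rewrite (eq_bigr (fun=> mu [set y])) // big_const_seq count_predT size_iota.
  rewrite iter_addr_0 mulr_natl => ->; apply: prob_le1 => //.
  exact: borel_bigcup_seq.
have := archi_boundP (ltW (divr_gt0 ltr01 y0)).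
rewrite ltr_pdivrMr //; have := key (Num.Def.archi_bound (1 / mu [set y])); lra.
Qed.

End PeriodicPoints.

(** * Towers *)

Record setup (R : realType) (X : pseudoMetricType R) (T Tinv : X -> X)
    (mu : set X -> R) (y : X) (E : nat -> set X) (P : nat -> set (set X)) : Prop := Setup {
  setup_hausdorff : hausdorff_space X;
  setup_compact : compact [set: X];
  setup_infinite : infinite_set [set: X];
  setup_cont : continuous T;
  setup_contV : continuous Tinv;
  setup_TK : cancel T Tinv;
  setup_TVK : cancel Tinv T;
  setup_prob : borel_probability mu;
  setup_full : full_measure mu;
  setup_inv : invariant_measure T mu;
  setup_erg : ergodic_measure T mu;
  setup_clopenE : forall n, clopen (E n);
  setup_decE : forall n, E n.+1 `<=` E n;
  setup_capE : \bigcap_n E n = [set y];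
  setup_finP : forall n, finite_set (P n);
  setup_clopenP : forall n Z, P n Z -> clopen Z /\ Z !=set0;
  setup_disjP : forall n Z Z', P n Z -> P n Z' -> Z `&` Z' !=set0 -> Z = Z';
  setup_covP : forall n, \bigcup_(Z in P n) Z = ~` E n;
  setup_refine : forall n B, P n.+1 B \/ B = E n.+1 ->
    exists2 B', P n B' \/ B' = E n & B `<=` B';
  setup_basis : forall (U : set X) (x : X), open U -> U x ->
    exists (k : nat) (B : nat -> set X),
      [/\ forall i, (i < k)%N -> exists n, P n (B i) \/ B i = E n,
          forall i, (i < k)%N -> B i x
        & forall z, (forall i, (i < k)%N -> B i z) -> U z]
}.

Section Towers.
Variables (R : realType) (X : pseudoMetricType R) (T Tinv : X -> X)
  (mu : set X -> R) (y : X) (E : nat -> set X) (P : nat -> set (set X)).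
Hypothesis S : setup T Tinv mu y E P.
Let cT := setup_cont S.
Let TK := setup_TK S.
Let clopenE := setup_clopenE S.
Let decE := setup_decE S.
Let finP := setup_finP S.
Let clopenP := setup_clopenP S.
Let disjP := setup_disjP S.
Let covP := setup_covP S.
Let refineP := setup_refine S.

Local Notation V := (V T E P).
Local Notation wlen := (wlen T E P).

Definition cell n (B : set X) := P n B \/ B = E n.

(** One implication already gives an equivalence relation, because the cells of level [n] partition
    [X]. *)
Definition same_cell n (x z : X) := forall B, cell n B -> B x -> B z.

Lemma PE_disj n Z x : P n Z -> Z x -> ~ E n x.
Proof. by move=> PZ Zx; have : (~` E n) x by rewrite -covP; exists Z. Qed.

Lemma cell_ex n x : exists2 B, cell n B & B x.
Proof.
case: (pselect (E n x)) => [Ex|nEx]; first by exists (E n) => //; right.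
have : (~` E n) x by []; rewrite -covP => -[Z PZ Zx]; exists Z => //; by left.
Qed.

Lemma cell_uniq n B B' x : cell n B -> cell n B' -> B x -> B' x -> B = B'.
Proof.
move=> [PB|->] [PB'|->] Bx B'x //.
- by apply: (disjP PB PB'); exists x.
- by case: (PE_disj PB Bx).
- by case: (PE_disj PB' B'x).
Qed.

Lemma same_cell_in n B x z : cell n B -> B x -> B z -> same_cell n x z.
Proof. by move=> cB Bx Bz C cC Cx; rewrite (cell_uniq cC cB Cx Bx). Qed.

Lemma same_cell_sym n x z : same_cell n x z -> same_cell n z x.
Proof.
move=> h; have [B cB Bx] := cell_ex n x.
exact: (same_cell_in cB (h B cB Bx) Bx).
Qed.

Lemma same_cell_trans n x z w : same_cell n x z -> same_cell n z w -> same_cell n x w.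
Proof. by move=> h h' B cB /(h B cB) /(h' B cB). Qed.

Lemma same_cell_E n x z : same_cell n x z -> E n x -> E n z.
Proof. by apply; right. Qed.

Lemma E_same_cell n x z : E n x -> E n z -> same_cell n x z.
Proof. by apply: same_cell_in; right. Qed.

(** By refinement, the cell of [x] at each level lies inside its cell at the preceding level. *)
Lemma same_cell_le n m x z : (n <= m)%N -> same_cell m x z -> same_cell n x z.
Proof.
move=> /subnK <-; elim: (m - n)%N => // d IH; rewrite addSn => h; apply: IH => B cB Bx.
have [C cC Cx] := cell_ex (d + n).+1 x.
have [B' cB' CB'] := refineP cC.
by rewrite (cell_uniq cB cB' Bx (CB' _ Cx)); apply: CB'; exact: h.
Qed.

Lemma cell_clopen n B : cell n B -> clopen B.
Proof. by move=> [/clopenP []|->]. Qed.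

Lemma E_le n m : (n <= m)%N -> E m `<=` E n.
Proof.
by move=> /subnK <-; elim: (m - n)%N => // d IH; apply: subset_trans IH; exact: decE.
Qed.

(** The intermediate letters are disjoint from [E n], so [k] is the first return time to [E n] of
    every point of [W]. In particular [k] is determined by [W], which justifies the choice made in
    [wlen]. *)
Lemma Vcell_return n W k z : Vcell T E P n W k -> W z ->
  [/\ E n z, E n (iter k T z), (0 < k)%N
    & forall i, (0 < i < k)%N -> ~ E n (iter i T z)].
Proof.
move=> [k0 [Zs [PZs ->]] _] [/= Ez Zz Ekz]; split=> // i ik.
exact: (PE_disj (PZs i ik) (Zz i ik)).
Qed.

Lemma Vcell_len n W k k' : Vcell T E P n W k -> Vcell T E P n W k' -> k = k'.
Proof.
move=> h h'; have [z Wz] : W !=set0 by case: h.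
have [_ Ek k0 nE] := Vcell_return h Wz; have [_ Ek' k0' nE'] := Vcell_return h' Wz.
case: (ltngtP k k') => // kk; first by case: (nE' k); rewrite ?k0.
by case: (nE k'); rewrite ?k0'.
Qed.

Lemma V_wlen n W : V n W -> Vcell T E P n W (wlen n W).
Proof.
move=> VW; rewrite /Defs.wlen; case: pselect => // -[k hk] /=.
by apply: epsilon_spec; exists k.
Qed.

Lemma V_ne n W : V n W -> W !=set0. Proof. by case=> k []. Qed.

Lemma V_return n W z : V n W -> W z ->
  [/\ E n z, E n (iter (wlen n W) T z), (0 < wlen n W)%N
    & forall i, (0 < i < wlen n W)%N -> ~ E n (iter i T z)].
Proof. by move=> /V_wlen; exact: Vcell_return. Qed.

(** The bound on [i] is inclusive: at time [wlen n W] both points are back in the single cell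
    [E n]. *)
Lemma V_same_cell n W z z' i : V n W -> W z -> W z' -> (i <= wlen n W)%N ->
  same_cell n (iter i T z) (iter i T z').
Proof.
move=> VW Wz Wz'; have [Ez Ekz k0 _] := V_return VW Wz.
have [Ez' Ekz' _ _] := V_return VW Wz'.
rewrite leq_eqVlt => /orP[/eqP->|ik]; first exact: E_same_cell.
case: (posnP i) => [->|i0]; first exact: E_same_cell.
case: (V_wlen VW) => _ [Zs [PZs WE]] _.
have ii : (1 <= i < wlen n W)%N by rewrite i0.
apply: (@same_cell_in n (Zs i)); first by left; exact: PZs.
  by move: Wz; rewrite {1}WE => -[_ + _]; exact.
by move: Wz'; rewrite {1}WE => -[_ + _]; exact.
Qed.

(** Converse of [V_same_cell]: membership in [W] only depends on the itinerary through the cells up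
    to the return time. *)
Lemma same_cell_V n W z z' : V n W -> W z ->
  (forall i, (i <= wlen n W)%N -> same_cell n (iter i T z) (iter i T z')) -> W z'.
Proof.
move=> VW + h; case: (V_wlen VW) => _ [Zs [PZs ->]] _ [/= Ez Zz Ekz]; split.
- exact: (same_cell_E (h 0%N _) Ez).
- move=> i ik; apply: (h i); [lia|by left; exact: PZs|exact: Zz].
- exact: (same_cell_E (h _ (leqnn _)) Ekz).
Qed.

Lemma V_exists n z k : E n z -> E n (iter k T z) -> (0 < k)%N ->
  (forall i, (0 < i < k)%N -> ~ E n (iter i T z)) ->
  exists W, [/\ V n W, W z & wlen n W = k].
Proof.
move=> Ez Ekz k0 nE.
pose Zs i := xget set0 [set Z | P n Z /\ Z (iter i T z)].
have ZsP i : (0 < i < k)%N -> P n (Zs i) /\ Zs i (iter i T z).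
  move=> ik; have : (~` E n) (iter i T z) by exact: nE.
  rewrite -covP => -[Z PZ Zz].
  exact: (@xgetPex _ set0 [set Z | P n Z /\ Z (iter i T z)] (ex_intro _ Z (conj PZ Zz))).
pose W := [set x | [/\ E n x, (forall i, (1 <= i < k)%N -> Zs i (iter i T x))
   & E n (iter k T x)]].
have Wz : W z by split=> // i /ZsP [].
have VW : Vcell T E P n W k.
  by split=> //; [exists Zs; split=> // i /ZsP []|exists z].
have VW' : V n W by exists k.
by exists W; split=> //; apply: Vcell_len (V_wlen VW') VW.
Qed.

Lemma V_uniq n W W' z : V n W -> V n W' -> W z -> W' z -> W = W'.
Proof.
have : forall W W' : set X, V n W -> V n W' -> W z -> W' z -> W `<=` W'.
  move=> {}W {}W' VW VW' Wz W'z.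
  have kk : wlen n W = wlen n W'.
    have [_ Ek k0 nE] := V_return VW Wz; have [_ Ek' k0' nE'] := V_return VW' W'z.
    case: (ltngtP (wlen n W) (wlen n W')) => // lk.
      by case: (nE' (wlen n W)); rewrite ?k0.
    by case: (nE (wlen n W')); rewrite ?k0'.
  move=> w Ww; apply: (same_cell_V VW' W'z) => i; rewrite -kk => ik.
  exact: (V_same_cell VW).
by move=> h VW VW' Wz W'z; apply/seteqP; split; exact: h.
Qed.

Lemma V_clopen n W : V n W -> clopen W.
Proof.
move=> [k [k0 [Zs [PZs ->]] _]].
pose F i := if (0 < i < k)%N then iter i T @^-1` Zs i else setT.
rewrite (_ : mkset _ = E n `&` [set x | forall i, (i < k)%N -> F i x]
   `&` (iter k T @^-1` E n)).
  apply: clopenI; last by apply: clopen_preimage => //; exact: continuous_iter.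
  apply: clopenI => //; apply: clopen_forall_lt => i; rewrite /F.
  case: ifP => [ik|_]; last exact: clopenT.
  apply: clopen_preimage; first exact: continuous_iter.
  by case: (clopenP (PZs _ ik)).
apply/seteqP; split=> x /=; rewrite /F.
  move=> [Ex Zx Ekx]; split=> //; split=> // i ik.
  by case: ifP => // ik'; exact: Zx.
move=> [[Ex Fx] Ekx]; split=> // i ik.
by have /= := Fx i (proj2 (andP ik)); rewrite ik.
Qed.

(** If [q < q'], cancelling [T] shows that [z] is an iterate of [z'] which returns to [E n] strictly
    before the return time of [z']. Hence all levels of all towers are pairwise disjoint. *)
Lemma tower_uniq n W W' z z' q q' : V n W -> V n W' -> W z -> W' z' ->
  (q < wlen n W)%N -> (q' < wlen n W')%N -> iter q T z = iter q' T z' ->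
  [/\ q = q', z = z' & W = W'].
Proof.
have : forall W W' z z' q q', V n W -> V n W' -> W z -> W' z' ->
   (q < wlen n W)%N -> (q' < wlen n W')%N -> (q <= q')%N ->
   iter q T z = iter q' T z' -> [/\ q = q', z = z' & W = W'].
  move=> {}W {}W' {}z {}z' {}q {}q' VW VW' Wz W'z' qk q'k' qq'.
  rewrite -(subnKC qq') iterD => /(iter_inj TK) e.
  have [Ez _ _ _] := V_return VW Wz; have [_ _ _ nE] := V_return VW' W'z'.
  case: (posnP (q' - q)%N) => [e0|d0].
    rewrite e0 /= in e; rewrite e0 addn0; split=> //.
    by apply: (V_uniq VW VW' Wz); rewrite e.
  by case: (nE (q' - q)%N); rewrite -?e //; lia.
move=> h VW VW' Wz Wz' qk qk' e; case: (leqP q q') => [le|/ltnW le].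
  exact: (h _ _ _ _ _ _ VW VW' Wz Wz' qk qk' le e).
by have [-> -> ->] := h _ _ _ _ _ _ VW' VW Wz' Wz qk' qk le (esym e).
Qed.

(** The start [j] is the last visit to [E n] up to time [q], and the block ends at the first visit
    after [q]. Both exist because [z] and its return lie in [E m], which is contained in [E n]. *)
Lemma block_exists n m W' z q : (n <= m)%N -> V m W' -> W' z ->
  (q < wlen m W')%N -> exists j W, [/\ V n W, W (iter j T z), (j <= q)%N,
    (q < j + wlen n W)%N & (j + wlen n W <= wlen m W')%N].
Proof.
move=> nm VW' W'z qk; have [Ez Ekz k0 nE] := V_return VW' W'z.
pose p j := (j <= q)%N && `[< E n (iter j T z) >].
have p0 : exists j, p j by exists 0%N; apply/andP; split=> //; apply/asboolP; exact: (E_le nm).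
have pq j : p j -> (j <= q)%N by case/andP.
case: (ex_maxnP p0 pq) => j /andP[jq /asboolP Ej] jmax.
pose p' e := (q < e)%N && `[< E n (iter e T z) >].
have p'k : p' (wlen m W') by rewrite /p' qk; apply/asboolP; exact: (E_le nm).
case: (ex_minnP (ex_intro (fun e => is_true (p' e)) _ p'k)) => e /andP[qe /asboolP Ee] emin.
have := @V_exists n (iter j T z) (e - j)%N Ej.
rewrite -iterD subnK; last by lia.
case=> [//||i ie|W [VW Wj We]]; first by lia.
  rewrite -iterD => Eij; case: (leqP (i + j) q) => iq.
    have := jmax (i + j)%N; rewrite /p iq; have -> : `[< E n (iter (i + j) T z) >] by apply/asboolP.
    by move=> /(_ isT); lia.
  have := emin (i + j)%N; rewrite /p' iq; have -> : `[< E n (iter (i + j) T z) >] by apply/asboolP.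
  by move=> /(_ isT); lia.
have ek := emin _ p'k.
by exists j, W; rewrite We; split=> //; lia.
Qed.

Lemma block_uniq n W W' z q j j' : V n W -> V n W' -> W (iter j T z) ->
  W' (iter j' T z) -> (j <= q < j + wlen n W)%N -> (j' <= q < j' + wlen n W')%N ->
  j = j' /\ W = W'.
Proof.
move=> VW VW' Wj Wj' /andP[jq qj] /andP[jq' qj'].
have [] := @tower_uniq n W W' _ _ (q - j)%N (q - j')%N VW VW' Wj Wj'.
- by lia.
- by lia.
- by rewrite -!iterD !subnK.
by move=> e _ ->; split=> //; lia.
Qed.

(** A tower of height at most [L] is determined by the cells of the first [L + 1] points of one
    orbit segment, and there are finitely many such itineraries; [f] sends an itinerary class to the
    base containing it. *)
Lemma short_towers_finite n L : finite_set [set W | V n W /\ (wlen n W <= L)%N].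
Proof.
pose cl L z := [set z' | forall i, (i < L)%N -> same_cell n (iter i T z) (iter i T z')].
have finQ M : finite_set [set c | exists z, c = cl M z].
  elim: M => [|M IH].
    apply: (@sub_finite_set _ _ [set setT]); last exact: finite_set1.
    by move=> c [z ->] /=; apply/seteqP; split.
  have finC : finite_set [set B | cell n B].
    rewrite (_ : mkset _ = P n `|` [set E n]); last by apply/seteqP; split.
    by rewrite finite_setU; split => //; exact: finite_set1.
  apply: sub_finite_set (finite_image2 (fun S B => S `&` (iter M T @^-1` B)) IH finC).
  move=> c [z ->]; have [B cB Bz] := cell_ex n (iter M T z).
  exists (cl M z); first by exists z.
  exists B => //; apply/seteqP; split=> z' /=.
    move=> [h Bz'] i; rewrite ltnS leq_eqVlt => /orP[/eqP->|]; last exact: h.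
    exact: (same_cell_in cB).
  by move=> h; split=> [i iM|]; [apply: h; exact: leqW|exact: (h M (ltnSn _) B)].
pose f c := xget set0 [set W | [/\ V n W, c `<=` W & c !=set0]].
apply: sub_finite_set (finite_image f (finQ L.+1)) => W [VW WL].
have [z Wz] := V_ne VW; exists (cl L.+1 z); first by exists z.
have clz : cl L.+1 z z by move=> i _.
have : [set W | [/\ V n W, cl L.+1 z `<=` W & cl L.+1 z !=set0]] (f (cl L.+1 z)).
  apply: xgetPex; exists W; split=> //; last by exists z.
  move=> w hw; apply: (same_cell_V VW Wz) => i ik; apply: hw; lia.
by move=> [VW' sW' _]; apply: (V_uniq VW' VW _ Wz); exact: sW'.
Qed.

Lemma same_cell_clopen n x : clopen [set z | same_cell n x z].
Proof.
have [B cB Bx] := cell_ex n x; rewrite (_ : mkset _ = B); first exact: (cell_clopen cB).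
by apply/seteqP; split=> z /=; [exact|exact: same_cell_in].
Qed.

(** The finitely many cells given by the topological basis are all refined by the cells of the
    largest level among them. *)
Lemma same_cell_nbhd U x : open U -> U x ->
  exists n, [set z | same_cell n x z] `<=` U.
Proof.
move=> oU Ux; have [k [B [cB Bx BU]]] := setup_basis S oU Ux.
suff [n hn] : exists n, forall z i, same_cell n x z -> (i < k)%N -> B i z.
  by exists n => z xz; apply: BU => i ik; exact: hn.
elim: k cB Bx {BU} => [|k IH] cB Bx; first by exists 0%N.
have [|i ik|n hn] := IH; [by move=> i ik; apply: cB; exact: leqW|by apply: Bx; exact: leqW|].
have [n' cBk] := cB k (ltnSn k).
exists (maxn n n') => z i xz; rewrite ltnS leq_eqVlt => /orP[/eqP->|].
  by apply: (same_cell_le (leq_maxr n n') xz) => //; exact: Bx.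
exact: (hn _ _ (same_cell_le (leq_maxl n n') xz)).
Qed.

Lemma clopen_basis (U : set X) x : open U -> U x ->
  exists C, [/\ clopen C, C x & C `<=` U].
Proof.
move=> oU /(same_cell_nbhd oU) [n hn].
by exists [set z | same_cell n x z]; split=> //; exact: same_cell_clopen.
Qed.

(** The points on whose level [n] cell [f] is constant form an open set, increasing with [n]. These
    sets cover [X], so by compactness one of them is everything. *)
Lemma locally_constant_same_cell (K : Type) (f : X -> K) : locally_constant f ->
  exists M, forall n x z, (M <= n)%N -> same_cell n x z -> f x = f z.
Proof.
move=> lf; pose G n := [set x | forall z, same_cell n x z -> f z = f x].
have [|n m nm x Gx z /(same_cell_le nm) /Gx //|x|M hM] := compact_increasing_cover (setup_compact S) (G := G).
- move=> n; rewrite openE => x Gx; rewrite /interior nbhsE.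
  exists [set z | same_cell n x z]; first by split=> //; case: (same_cell_clopen n x).
  by move=> z xz w zw; rewrite (Gx z xz); apply: Gx; exact: same_cell_trans zw.
- have [U [oU Ux fU]] := lf x; have [n hn] := same_cell_nbhd oU Ux.
  by exists n => z /hn /fU.
by exists M => n x z Mn xz; rewrite (hM x z) //; exact: same_cell_le xz.
Qed.

End Towers.

(** * The rank functions *)

Section Rank.
Variable K : fieldType.

(** The matrix is the sum of its rows, each placed by a column vector: a nonzero row contributes
    rank at most 1 and a zero row contributes 0. *)
Lemma mxrank_le_nonzero_rows k (A : 'M[K]_k) :
  (\rank A <= #|[pred p : 'I_k | [exists q, A p q != 0%R]]|)%N.
Proof.
have AE : A = \sum_p delta_mx p (0 : 'I_1) *m row p A.
  apply/matrixP => i j; rewrite summxE (bigD1 i) //= big1 => [|p pi].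
    by rewrite addr0 mxE big_ord1 !mxE !eqxx mul1r.
  by rewrite mxE big_ord1 !mxE eq_sym (negPf pi) mul0r.
set S := [pred p : 'I_k | _]; rewrite {1}AE -sum1_card.
have -> : (\sum_(p in S) 1 = \sum_p (p \in S))%N by rewrite big_mkcond.
elim/big_ind2: _ => [|B n C m Bn Cm|p _]; first by rewrite mxrank0.
  by apply: leq_trans (mxrank_add _ _) _; exact: leq_add.
case: (boolP (p \in S)) => [_|].
  by apply: leq_trans (mxrankM_maxl _ _) _; exact: rank_leq_col.
rewrite inE negb_exists => /forallP Ap.
rewrite (_ : row p A = 0) ?mulmx0 ?mxrank0 //.
by apply/rowP => q; rewrite !mxE; move: (Ap q); rewrite negbK => /eqP.
Qed.

(** The submatrix with rows [p] and columns [g p], for [p] in [S], is diagonal with nonzero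
    diagonal, hence invertible, and its rank is at most that of [A]. *)
Lemma mxrank_ge_diag k (A : 'M[K]_k) (S : {pred 'I_k}) (g : 'I_k -> 'I_k) :
  (forall p, p \in S -> A p (g p) != 0) ->
  (forall p p', p \in S -> p' \in S -> p != p' -> A p (g p') = 0) ->
  (#|S| <= \rank A)%N.
Proof.
move=> nz z; pose f (i : 'I_#|S|) : 'I_k := enum_val i.
pose B := rowsub f A; have BA : (\rank B <= \rank A)%N := mxrankS (rowsub_sub f A).
pose D := rowsub (g \o f) B^T.
have DB : (\rank D <= \rank B)%N by rewrite -(mxrank_tr B); exact: mxrankS (rowsub_sub _ _).
suff uD : D \in unitmx.
  by have := mxrank_unit uD; move=> DS; rewrite -{1}DS; exact: leq_trans DB BA.
have -> : D = diag_mx (\row_i A (f i) (g (f i))).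
  apply/matrixP => i j; rewrite !mxE; case: (eqVneq i j) => [->|ij]; first by rewrite mulr1n.
  rewrite mulr0n; apply: z; rewrite ?enum_valP // eq_sym.
  by apply: contraNneq ij => /enum_val_inj ->.
rewrite unitmxE det_diag unitfE; apply/prodf_neq0 => i _; rewrite mxE.
by apply: nz; exact: enum_valP.
Qed.

End Rank.

(** * Comparing the rank functions with the measure *)

Section Measure.
Variables (R : realType) (X : pseudoMetricType R) (T Tinv : X -> X)
  (mu : set X -> R) (y : X) (E : nat -> set X) (P : nat -> set (set X)).
Hypothesis S : setup T Tinv mu y E P.
Let cT := setup_cont S.
Let cTinv := setup_contV S.
Let TK := setup_TK S.
Let TinvK := setup_TVK S.
Let mu_prob := setup_prob S.
Let clopenE := setup_clopenE S.
Variable K : fieldType.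

Local Notation V := (V T E P).
Local Notation wlen := (wlen T E P).
Local Notation Rn := (Rn T K E P).

Lemma iterK q x : iter q Tinv (iter q T x) = x.
Proof. by elim: q => // q IH; rewrite iterSr iterS TK. Qed.

Lemma iterVK q x : iter q T (iter q Tinv x) = x.
Proof. by elim: q => // q IH; rewrite iterSr iterS TinvK. Qed.

Lemma mu_iterV q A : borel_set A -> mu (iter q Tinv @^-1` A) = mu A.
Proof.
move=> bA; have bq : borel_set (iter q Tinv @^-1` A).
  by apply: borel_preimage => //; exact: continuous_iter.
rewrite -(invariant_iter cT (setup_inv S) q bq); congr (mu _).
by apply/seteqP; split=> x /=; rewrite iterK.
Qed.

(** With [ergodic_inv], this lets recurrence be applied to negative times, as is needed to find the
    base below a given point. *)
Lemma invariant_inv : invariant_measure Tinv mu.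
Proof. by move=> A bA; exact: (mu_iterV 1). Qed.

Lemma ergodic_inv : ergodic_measure Tinv mu.
Proof.
move=> A bA TA; apply: (setup_erg S) => //.
by rewrite -{1}TA; apply/seteqP; split=> x /=; rewrite TK.
Qed.

(** The level [q] of the tower over [W], that is the image of [W] under [iter q T], written as a
    preimage so that it is visibly Borel. *)
Definition level q (W : set X) := iter q Tinv @^-1` W.

Lemma levelP q W x : level q W x <-> exists2 z, W z & x = iter q T z.
Proof.
split=> [Wx|[z Wz ->]]; last by rewrite /level /= iterK.
by exists (iter q Tinv x) => //; rewrite iterVK.
Qed.

Lemma borel_V n W : V n W -> borel_set W.
Proof. by move=> VW; apply: borel_clopen; exact: (V_clopen S VW). Qed.

Lemma borel_level q n W : V n W -> borel_set (level q W).
Proof.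
by move=> VW; apply: borel_preimage; [exact: continuous_iter|exact: (borel_V VW)].
Qed.

Definition levels (s : seq (set X)) (Q : set X -> seq nat) : set X :=
  [set x | exists W q, [/\ W \in s, q \in Q W & level q W x]].

(** The levels are pairwise disjoint by [tower_uniq], and each has the measure of its base. This
    turns sums of row counts weighted by [mu W] into measures of sets. *)
Lemma mu_levels n (s : seq (set X)) (Q : set X -> seq nat) :
  uniq s -> (forall W, W \in s -> V n W) -> (forall W, uniq (Q W)) ->
  (forall W q, q \in Q W -> (q < wlen n W)%N) ->
  borel_set (levels s Q) /\
  \sum_(W <- s) mu W * (size (Q W))%:R = mu (levels s Q).
Proof.
move=> us sV uQ Qlt; pose prs := [seq (W, q) | W <- s, q <- Q W].
have prsP p : p \in prs -> p.1 \in s /\ p.2 \in Q p.1.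
  by case/allpairsPdep => W [q [Ws qQ ->]].
have LE : levels s Q = \bigcup_(p in [set` prs]) level p.2 p.1.
  apply/seteqP; split=> x.
    by move=> [W [q [Ws qQ lx]]]; exists (W, q) => //=; apply/allpairsPdep; exists W, q.
  by move=> [p /= /prsP [ps pQ] lx]; exists p.1, p.2.
have bp p : p \in prs -> borel_set (level p.2 p.1).
  by move=> /prsP [/sV Vp _]; exact: borel_level Vp.
split; first by rewrite LE; exact: borel_bigcup_seq.
rewrite LE -prob_sum //.
- rewrite big_allpairs_dep; apply: eq_big_seq => W Ws /=.
  rewrite (eq_bigr (fun=> mu W)) => [|q _]; last by apply: mu_iterV; exact: borel_V (sV _ Ws).
  by rewrite big_const_seq count_predT iter_addr_0 mulr_natr.
- apply: allpairs_uniq_dep => //; move=> [W q] [W' q'] _ _ /= [-> ->] //.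
- move=> [W q] [W' q'] x /prsP /= [Ws qQ] /prsP /= [Ws' qQ'].
  move=> /levelP [z Wz ->] /levelP [z' Wz' e].
  have [-> _ ->] // := tower_uniq S (sV _ Ws) (sV _ Ws') Wz Wz' (Qlt _ _ qQ) (Qlt _ _ qQ') e.
Qed.

(** For each finite family of towers, the nonzero rows correspond to disjoint levels contained in
    [B], and [rkn] is a supremum over finite families. *)
Lemma rkn_le n (x : Rn n) B : borel_set B ->
  (forall W z (q r : 'I_(wlen n W)), V n W -> W z -> x W q r != 0 -> B (iter q T z)) ->
  (rkn mu x <= (mu B)%:E)%E.
Proof.
move=> bB hB; apply: ge_ereal_sup => _ [F [finF FV] <-].
rewrite fsbig_finite // sumEFin lee_fin.
set s := finmap.enum_fset _; have us : uniq s by exact: finmap.fset_uniq.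
have sV W : W \in s -> V n W.
  by move=> Ws; apply: FV; apply: set_mem; rewrite -(in_fset_set finF).
pose Q W := [seq val p | p <- enum [pred p : 'I_(wlen n W) | [exists q, x W p q != 0%R]]].
have uQ W : uniq (Q W) by rewrite map_inj_uniq ?enum_uniq //; exact: val_inj.
have Qlt W q : q \in Q W -> (q < wlen n W)%N by case/mapP => p _ ->; exact: ltn_ord.
have [bL muL] := mu_levels us sV uQ Qlt.
apply: (@le_trans _ _ (mu (levels s Q))).
  rewrite -muL big_seq [leRHS]big_seq; apply: ler_sum => W Ws.
  rewrite ler_wpM2l ?prob_ge0 //; first exact: borel_V (sV _ Ws).
  by rewrite ler_nat size_map -cardE; exact: mxrank_le_nonzero_rows.
apply: prob_le => // w [W [q [Ws /mapP [p]]]].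
rewrite mem_enum inE => /existsP [r xr] -> /levelP [z Wz ->].
exact: (hB W z p r (sV _ Ws) Wz xr).
Qed.

(** Outside a set of measure less than [e], recurrence for [T] and for [Tinv] gives visits to [E n]
    within bounded time in both directions, so the point lies in a tower of height at most
    [L1 + L2]. *)
Lemma towers_cover n (e : R) : 0 < e -> exists L G, [/\ borel_set G, mu (~` G) < e
  & forall w, G w -> exists W z q,
      [/\ V n W, (wlen n W <= L)%N, W z, (q < wlen n W)%N & w = iter q T z]].
Proof.
move=> e0; have e2 : 0 < e / 2 by lra.
have Ey : E n y.
  by have : (\bigcap_n E n) y; [rewrite (setup_capE S)|move/(_ n I)].
have E0 : 0 < mu (E n) by apply: (setup_full S); [case: (clopenE n)|exists y].
have bE := borel_clopen (clopenE n).
have [L1 h1] := hitting_set_lt mu_prob cT (setup_inv S) (setup_erg S) bE E0 e2.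
have [L2 h2] := hitting_set_lt mu_prob cTinv invariant_inv ergodic_inv bE E0 e2.
set F1 := [set x | _] in h1; set F2 := [set x | _] in h2.
have b1 : borel_set F1.
  apply: borel_clopen; apply: clopen_exists_lt => j.
  by apply: (@clopen_preimage _ _ (iter j.+1 T)) => //; exact: continuous_iter.
have b2 : borel_set F2.
  apply: borel_clopen; apply: clopen_exists_lt => j.
  by apply: (@clopen_preimage _ _ (iter j.+1 Tinv)) => //; exact: continuous_iter.
exists (L1 + L2)%N, (F1 `&` F2); split; first exact: borel_setI.
  rewrite setCI; apply: le_lt_trans (probU_le mu_prob _ _) _; try exact: borel_setC.
  by rewrite !probC //; lra.
move=> w [[j1 jL1 Ej1] [j2 jL2 Ej2]].
(* The next visit must be at a positive time, whereas the last one may be at time 0, when [w] itself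
   lies in a base. *)
pose p1 q := (0 < q)%N && `[< E n (iter q T w) >].
pose p2 p := `[< E n (iter p Tinv w) >].
have ex1 : exists q, p1 q by exists j1.+1; apply/asboolP.
have ex2 : exists q, p2 q by exists j2.+1; apply/asboolP.
case: (ex_minnP ex1) => q /andP[q0 /asboolP Eq] qmin.
case: (ex_minnP ex2) => p /asboolP Ep pmin.
have qj : (q <= j1.+1)%N by apply: qmin; apply/asboolP.
have pj : (p <= j2.+1)%N by apply: pmin; apply/asboolP.
have Tz i : (i <= p)%N -> iter i T (iter p Tinv w) = iter (p - i) Tinv w.
  by move=> ip; rewrite -{1}(subnKC ip) iterD iterVK.
have Tz' i : (p <= i)%N -> iter i T (iter p Tinv w) = iter (i - p) T w.
  by move=> ip; rewrite -{1}(subnK ip) iterD iterVK.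
have [||i ik|W [VW Wz Wk]] := V_exists S (k := (p + q)%N) Ep.
- by rewrite Tz' ?leq_addr // addKn.
- by lia.
- case: (leqP i p) => ip.
    rewrite Tz // => Ei; have : (p <= p - i)%N by apply: pmin; apply/asboolP.
    lia.
  rewrite Tz'; last exact: ltnW.
  move=> Ei; have : (q <= i - p)%N by apply: qmin; apply/andP; split; [lia|apply/asboolP].
  lia.
exists W, (iter p Tinv w), p; rewrite Wk iterVK; split=> //; lia.
Qed.

(** Up to measure [e], the set [A] is covered by the levels that it meets in the finitely many
    towers of height at most [L]; these levels are counted by the ranks. *)
Lemma rkn_ge n (x : Rn n) A : borel_set A ->
  (forall W, V n W ->
     (#|[pred p : 'I_(wlen n W) | `[< exists2 z, W z & A (iter p T z) >]]|
        <= \rank (x W))%N) ->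
  ((mu A)%:E <= rkn mu x)%E.
Proof.
move=> bA hA; apply/lee_addgt0Pr => e e0.
have [L [G [bG muG hG]]] := towers_cover n e0.
set F := [set W | V n W /\ (wlen n W <= L)%N].
have finF : finite_set F := short_towers_finite S n L.
pose s := finmap.enum_fset (fset_set F).
have us : uniq s by exact: finmap.fset_uniq.
have sF W : (W \in s) = (W \in F) by exact: (in_fset_set finF).
have sV W : W \in s -> V n W by rewrite sF inE => -[].
pose Q W := [seq val p | p <- enum [pred p : 'I_(wlen n W) | `[< exists2 z, W z & A (iter p T z) >]]].
have uQ W : uniq (Q W) by rewrite map_inj_uniq ?enum_uniq //; exact: val_inj.
have Qlt W q : q \in Q W -> (q < wlen n W)%N by case/mapP => p _ ->; exact: ltn_ord.
have [bL muL] := mu_levels us sV uQ Qlt.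
apply: (@le_trans _ _ ((\sum_(W <- s) mu W * (\rank (x W))%:R)%:E + e%:E)%E).
  rewrite -EFinD lee_fin; apply: (@le_trans _ _ (mu (levels s Q) + e)); last first.
    rewrite lerD2r -muL big_seq [leRHS]big_seq; apply: ler_sum => W Ws.
    rewrite ler_wpM2l ?prob_ge0 //; first exact: borel_V (sV _ Ws).
    by rewrite ler_nat size_map -cardE; apply: hA; exact: sV.
  apply: le_trans (_ : mu (levels s Q `|` ~` G) <= _).
    apply: prob_le => //; first by apply: borel_setU => //; exact: borel_setC.
    move=> w Aw; case: (pselect (G w)) => Gw; last by right.
    left; have [W [z [q [VW WL Wz qk we]]]] := hG w Gw.
    exists W, q; split; first by rewrite sF inE.
      apply/mapP; exists (Ordinal qk) => //; rewrite mem_enum; apply: (introT (asboolP (exists2 z, W z & A (iter q T z)))).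
      by move: Aw; rewrite we; exists z.
    by apply/levelP; exists z.
  apply: le_trans (probU_le mu_prob bL (borel_setC bG)) _.
  by rewrite lerD2l ltW.
rewrite leeD2r // /rkn; apply: esum_ge; exists F; first by split=> // W [].
by rewrite fsbig_finite // sumEFin.
Qed.

Lemma rkn_add_le n (x x' : Rn n) :
  (rkn mu (Radd x x') <= rkn mu x + rkn mu x')%E.
Proof.
have mu0 W : V n W -> 0 <= mu W by move=> /borel_V; exact: prob_ge0.
rewrite /rkn -esumD => [|W VW|W VW]; try by rewrite lee_fin mulr_ge0 ?mu0.
apply: le_esum => W VW; rewrite -EFinD lee_fin -mulrDr ler_wpM2l ?mu0 //.
by rewrite -natrD ler_nat; exact: mxrank_add.
Qed.

Lemma rkn_subC n (x x' : Rn n) : rkn mu (Rsub x x') = rkn mu (Rsub x' x).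
Proof.
apply: eq_esum => W _; rewrite /Rsub -(opprB (x' W) (x W)) mxrank_opp //.
Qed.

(** The points within [N] steps of [E n] in either time direction: outside of it, a point is more
    than [N] levels away from both ends of its tower. *)
Definition boundary N n := [set w | exists2 j, (j < N.+1)%N &
   (iter j T @^-1` E n `|` iter j Tinv @^-1` E n) w].

Lemma clopen_boundary N n : clopen (boundary N n).
Proof.
apply: (@clopen_exists_lt _ (fun j => iter j T @^-1` E n `|` iter j Tinv @^-1` E n)) => j.
by apply: clopenU; apply: clopen_preimage => //; exact: continuous_iter.
Qed.

Lemma mu_boundary_le N n : mu (boundary N n) <= N.+1%:R * (2 * mu (E n)).
Proof.
pose F j := iter j T @^-1` E n `|` iter j Tinv @^-1` E n.
have bE := borel_clopen (clopenE n).
have b1 j : borel_set (iter j T @^-1` E n).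
  by apply: borel_preimage => //; exact: continuous_iter.
have b2 j : borel_set (iter j Tinv @^-1` E n).
  by apply: borel_preimage => //; exact: continuous_iter.
rewrite (_ : boundary N n = \bigcup_(j in [set` iota 0 N.+1]) F j); last first.
  apply/seteqP; split=> w [j]; first by move=> jN Fj; exists j => //; rewrite /mkset mem_iota.
  by rewrite /mkset mem_iota => jN Fj; exists j.
apply: le_trans (prob_bigcup_le mu_prob _) _; first by move=> j _; exact: borel_setU.
apply: (@le_trans _ _ (\sum_(j <- iota 0 N.+1) (2 * mu (E n)))).
  apply: ler_sum => j _; apply: le_trans (probU_le mu_prob (b1 j) (b2 j)) _.
  by rewrite (invariant_iter cT (setup_inv S)) // mu_iterV //; lra.
by rewrite big_const_seq count_predT size_iota iter_addr_0 [leRHS]mulr_natl.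
Qed.

Lemma mu_boundary_small N (e : R) : 0 < e -> exists M, forall m, (M <= m)%N ->
  mu (boundary N m) < e.
Proof.
(* Scaled so that [mu (E m) < e'] makes the bound of [mu_boundary_le] less than [e]. *)
move=> e0; pose e' := e / (N.+1%:R * 2); have e'0 : 0 < e' by rewrite divr_gt0 // mulr_gt0.
have [n|n m nm|M hM] := prob_decreasing mu_prob (F := E) _ _ e'0.
- exact: borel_clopen.
- exact: (E_le S nm).
exists M => m /hM; rewrite (setup_capE S) (@singleton_null R X mu T Tinv) ?add0r; first last.
- exact: (setup_erg S).
- exact: (setup_inv S).
- exact: (setup_full S).
- exact: mu_prob.
- exact: TK.
- exact: cT.
- exact: (clopen_basis S).
- exact: (setup_infinite S).
- exact: (setup_hausdorff S).
rewrite /e' ltr_pdivlMr ?mulr_gt0 // => h; apply: le_lt_trans (mu_boundary_le N m) _.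
by rewrite mulrA mulrC.
Qed.

End Measure.

(** * The connecting maps *)

Section Windows.
Variable K : fieldType.

Lemma sum_ord_pick k (v : int) (G : int -> K) :
  \sum_(r < k) (if r%:Z == v then G v else 0) =
  if (0 <= v) && (v < k%:Z) then G v else 0.
Proof.
case: ifP => [/andP[v0 vk]|hv].
  have vk' : (`|v| < k)%N by lia.
  rewrite (bigD1 (Ordinal vk')) //= big1 => [|r rv].
    by rewrite addr0; case: eqP => // ?; lia.
  by case: eqP => // e; case/eqP: rv; apply: val_inj => /=; lia.
rewrite big1 // => r _; case: eqP => // e.
by move/negP: hv; case; have := ltn_ord r; lia.
Qed.

(** Passes from a convolution, summed over the degree [i], to a matrix product, summed over the
    column [p - i]. Both index sets contain the support of [G]; the proof inserts a Kronecker symbol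
    and exchanges the sums. *)
Lemma sum_window (G : int -> K) c k (p : nat) :
  (forall i : int, (c < `|i|)%N -> G i = 0) ->
  (forall i : int, ~~ ((0 <= p%:Z - i) && (p%:Z - i < k%:Z)) -> G i = 0) ->
  \sum_(m < c.*2.+1) G (m%:Z - c%:Z) = \sum_(r < k) G (p%:Z - r%:Z).
Proof.
move=> Gc Gk.
transitivity (\sum_(m < c.*2.+1) \sum_(r < k)
    (if r%:Z == p%:Z - (m%:Z - c%:Z) then G (m%:Z - c%:Z) else 0)).
  apply: eq_bigr => m _; rewrite (sum_ord_pick k _ (fun=> G (m%:Z - c%:Z))).
  by case: ifP => // /negbT /Gk.
rewrite exchange_big; apply: eq_bigr => r _.
rewrite (eq_bigr (fun m : 'I__ => if m%:Z == c%:Z + p%:Z - r%:Z then G (p%:Z - r%:Z) else 0)).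
  rewrite (sum_ord_pick _ _ (fun=> G (p%:Z - r%:Z))).
  by case: ifP => // /negP h; rewrite Gc //; lia.
move=> m _; have -> : (r%:Z == p%:Z - (m%:Z - c%:Z)) = (m%:Z == c%:Z + p%:Z - r%:Z) by lia.
by case: eqP => // e; congr (G _); lia.
Qed.

(* Entries indexed by integers, 0 outside of the matrix. *)
Definition mget k (A : 'M[K]_k) (u v : int) : K :=
  \sum_i \sum_j A i j * ((i%:Z == u) && (j%:Z == v))%:R.

Lemma mget_ord k (A : 'M[K]_k) (p q : 'I_k) : mget A p q = A p q.
Proof.
rewrite /mget (bigD1 p) //= [X in _ + X]big1 ?addr0 => [|i ip].
  rewrite (bigD1 q) //= [X in _ + X]big1 ?addr0 ?eqxx ?mulr1 // => j jq.
  by rewrite eqz_nat [(j : nat) == _](negPf jq) andbF mulr0.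
by rewrite big1 // => j _; rewrite eqz_nat [(i : nat) == _](negPf ip) mulr0.
Qed.

Lemma mget_out k (A : 'M[K]_k) (u v : int) :
  ~~ [&& 0 <= u, u < k%:Z, 0 <= v & v < k%:Z] -> mget A u v = 0.
Proof.
move=> h; rewrite /mget big1 // => i _; rewrite big1 // => j _.
case: eqP => [e|_]; last by rewrite mulr0.
case: eqP => [e'|_]; last by rewrite mulr0.
by case/negP: h; have := ltn_ord i; have := ltn_ord j; lia.
Qed.

Variant mget_spec k (A : 'M[K]_k) (u v : int) : K -> Prop :=
  | MgetIn (p q : 'I_k) of u = p%:Z & v = q%:Z : mget_spec A u v (A p q)
  | MgetOut of ~~ [&& 0 <= u, u < k%:Z, 0 <= v & v < k%:Z] : mget_spec A u v 0.

Lemma mgetP k (A : 'M[K]_k) u v : mget_spec A u v (mget A u v).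
Proof.
case: (boolP [&& 0 <= u, u < k%:Z, 0 <= v & v < k%:Z]) => h; last first.
  by rewrite mget_out //; right.
have pk : (`|u| < k)%N by lia.
have qk : (`|v| < k)%N by lia.
have -> : mget A u v = A (Ordinal pk) (Ordinal qk).
  by rewrite -mget_ord /=; congr mget; lia.
by left => /=; lia.
Qed.

Lemma mgetD k (A B : 'M[K]_k) u v : mget (A + B) u v = mget A u v + mget B u v.
Proof.
rewrite /mget -big_split; apply: eq_bigr => i _; rewrite -big_split.
by apply: eq_bigr => j _; rewrite mxE mulrDl.
Qed.

Lemma mgetZ k l (A : 'M[K]_k) u v : mget (l *: A) u v = l * mget A u v.
Proof.
rewrite /mget mulr_sumr; apply: eq_bigr => i _; rewrite mulr_sumr.
by apply: eq_bigr => j _; rewrite mxE mulrA.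
Qed.

Lemma mgetM k (A B : 'M[K]_k) (p : 'I_k) v :
  mget (A *m B) p v = \sum_r A p r * mget B r v.
Proof.
case: (mgetP (A *m B) p v) => [p' q /eqP|].
  rewrite eqz_nat => /eqP /val_inj <- ->; rewrite mxE; apply: eq_bigr => r _.
  by rewrite mget_ord.
move=> h; rewrite big1 // => r _; rewrite mget_out ?mulr0 //.
by apply: contra h; have := ltn_ord p; lia.
Qed.

End Windows.

(** * Block structure of the connecting maps *)

Section Connecting.
Variables (R : realType) (X : pseudoMetricType R) (T Tinv : X -> X)
  (mu : set X -> R) (y : X) (E : nat -> set X) (P : nat -> set (set X)).
Hypothesis S : setup T Tinv mu y E P.
Variable K : fieldType.

Local Notation V := (V T E P).
Local Notation wlen := (wlen T E P).
Local Notation Rn := (Rn T K E P).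

(** All points of [W'] share their itinerary of level [m], hence of level [n], as long as the block
    stays within the tower over [W']. *)
Lemma image_tower_sub n m W W' z j : (n <= m)%N -> V m W' -> W' z -> V n W ->
  W (iter j T z) -> (j + wlen n W <= wlen m W')%N -> iter j T @` W' `<=` W.
Proof.
move=> nm VW' W'z VW Wj jk _ [w W'w <-].
apply: (same_cell_V VW Wj) => i ik; rewrite -!iterD.
by apply: (same_cell_le S nm); apply: (V_same_cell S VW') => //; lia.
Qed.

(** Among the summands of [jn], only the block containing the row [q] contributes, by [block_uniq],
    and the base chosen by [epsilon] for it must be [W]. *)
Lemma jnE n (x : Rn n) W' z (q r : 'I_(wlen n.+1 W')) j W :
  V n.+1 W' -> W' z -> V n W -> W (iter j T z) ->
  (j <= q < j + wlen n W)%N -> (j + wlen n W <= wlen n.+1 W')%N ->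
  jn x W' q r = mget (x W) (q%:Z - j%:Z) (r%:Z - j%:Z).
Proof.
move=> VW' W'z VW Wj jq jk.
have block1 (j' : 'I_(wlen n.+1 W')) W1 : V n W1 -> iter j' T @` W' `<=` W1 ->
    (\sum_(i < wlen n W1) \sum_(l < wlen n W1)
       x W1 i l *: emx K (wlen n.+1 W') (i + j') (l + j')) q r =
    mget (x W1) (q%:Z - j'%:Z) (r%:Z - j'%:Z).
  move=> VW1 sW1; rewrite summxE; apply: eq_bigr => i _; rewrite summxE.
  apply: eq_bigr => l _; rewrite !mxE; congr (_ * _%:R).
  by congr (nat_of_bool _); lia.
have jlt : (j < wlen n.+1 W')%N by have := ltn_ord q; lia.
rewrite /jn summxE (bigD1 (Ordinal jlt)) //= [X in _ + X]big1 => [|j' j'j]; last first.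
  destruct pselect as [ex|nex] => /=; last by rewrite mxE.
  have [VW1 sW1] := epsilon_spec (inhabits set0) _ ex.
  move: (epsilon _ _) VW1 sW1 => W1 VW1 sW1.
  rewrite block1 //; apply: mget_out; apply/negP => h.
  case/eqP: j'j; apply: val_inj => /=.
  have W1j' : W1 (iter j' T z) by apply: sW1; exists z.
  by have [] // := block_uniq S (q := q) VW1 VW W1j' Wj; lia.
rewrite addr0; destruct pselect as [ex|nex] => /=; last first.
  by case: nex; exists W; split=> //; exact: (image_tower_sub (leqnSn n) VW' W'z VW Wj jk).
have [VW1 sW1] := epsilon_spec (inhabits set0) _ ex.
move: (epsilon _ _) VW1 sW1 => W1 VW1 sW1.
rewrite (block1 (Ordinal jlt)) //.
suff -> : W1 = W by [].
by apply: (V_uniq S VW1 VW _ Wj); apply: sW1; exists z.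
Qed.

(* The matrix [x' W'] is block diagonal, its blocks being the matrices [x W] of
   the towers of level [n] successively crossed by that of [W']. *)
Definition block_diagonal n m (x : Rn n) (x' : Rn m) :=
  forall W' z (q r : 'I_(wlen m W')) j W, V m W' -> W' z -> V n W ->
    W (iter j T z) -> (j <= q < j + wlen n W)%N -> (j + wlen n W <= wlen m W')%N ->
    x' W' q r = mget (x W) (q%:Z - j%:Z) (r%:Z - j%:Z).

(** Induction on [d]: the row [q] lies in a block [W1] of level [d + n], which itself splits into
    blocks of level [n]; uniqueness identifies the one containing [q] with [W]. *)
Lemma jup_block n d (x : Rn n) : block_diagonal x (jup d x).
Proof.
elim: d => [|d IH] W' z q r j W VW' W'z VW Wj jq jk.
  have [|||e1 _ e2] := @tower_uniq _ _ _ _ _ _ _ _ S n _ _ _ _ q (q - j)%N VW' VW W'z Wj.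
  - exact: ltn_ord.
  - lia.
  - by rewrite -iterD subnK //; lia.
  have j0 : j = 0%N by move: jq; lia.
  by move: {Wj jk jq VW} e2 => <-; rewrite j0 !subr0 mget_ord.
change (d.+1 + n)%N with (d + n).+1 in *.
have [j1 [W1 [VW1 W1j jq1 qj1 jk1]]] := block_exists S (leqnSn (d + n)) VW' W'z (ltn_ord q).
rewrite /= (jnE _ _ VW' W'z VW1 W1j) ?jq1 //.
have qk1 : (q - j1 < wlen (d + n) W1)%N by lia.
have [j0 [W0 [VW0 W0j jq0 qj0 jk0]]] := block_exists S (leq_addl d n) VW1 W1j qk1.
rewrite -iterD in W0j.
have [|e e'] := block_uniq S (q := q) VW0 VW W0j Wj _ jq; first lia.
(* Either both indices fall in the block of [W1], and the induction hypothesis applies, or one falls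
   outside of it, hence outside of the smaller block of [W]. *)
subst W0 j; case: (mgetP (jup d x W1)) => [q' r' eq' er'|h].
  rewrite (IH W1 _ q' r' j0 W VW1 W1j VW); first by congr mget; lia.
  - by rewrite -iterD.
  - lia.
  - lia.
rewrite mget_out //; apply: contra h; lia.
Qed.

Lemma embed_block n m (x : Rn n) : (n <= m)%N -> block_diagonal x (embed x m).
Proof.
(* The cast is removed by generalizing [m - n + n] and then identifying it with [m]. *)
move=> nm; rewrite /embed; move: (erefl _).
case: {2 3}(n <= m)%N => [{}nm|]; last by rewrite nm.
move: {nm}(subnK nm) (@jup_block n (m - n)%N x); move: (jup _ _).
by move: (m - n + n)%N => a u; case: m / => u'.
Qed.

End Connecting.

(** * The algebras [A_n] and the maps [pi_n] *)

Section CrossedProductFacts.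
Variables (X : topologicalType) (T Tinv : X -> X) (K : fieldType).
Hypotheses (cT : continuous T) (cTinv : continuous Tinv).
Local Notation cp := (cp X K).
Local Notation cpmul := (cpmul T Tinv).
Implicit Types a b : cp.

Lemma chiE (U : set X) x : (chi U x : K) = (`[< U x >])%:R.
Proof. by rewrite /chi; case: asbool. Qed.

Lemma chi1 (U : set X) x : U x -> chi U x = 1 :> K.
Proof. by move=> Ux; rewrite /chi asboolT. Qed.

Lemma chi0 (U : set X) x : ~ U x -> chi U x = 0 :> K.
Proof. by move=> Ux; rewrite /chi asboolF. Qed.

Lemma cpsumE (I : Type) (r : seq I) (F : I -> cp) k x :
  cpsum r F k x = \sum_(i <- r) F i k x.
Proof. by elim: r => [|i r IH] /=; rewrite ?big_nil // big_cons -IH. Qed.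

Lemma cbndP a : (exists N : nat, forall i : int, (N < `|i|)%N -> forall x, a i x = 0) ->
  forall i : int, (cbnd a < `|i|)%N -> forall x, a i x = 0.
Proof. by move=> ex; exact: (epsilon_spec (inhabits 0%N) _ ex). Qed.

(** [cbnd] is only known to bound the support: if [k0] falls outside of the summation window, then
    [f x] is 0 and both sides vanish. *)
Lemma cpmul_monoE (f : X -> K) k0 b k x :
  cpmul (cpmono f k0) b k x = f x * b (k - k0) (Tpow T Tinv (- k0) x).
Proof.
rewrite /Defs.cpmul /=; set a := cpmono f k0; set c := cbnd a.
have hc : forall i : int, (c < `|i|)%N -> forall x, a i x = 0.
  by apply: cbndP; exists `|k0|%N => i ik z; rewrite /a /cpmono; case: eqP => // e; lia.
pose G (v : int) := f x * b (k - (v - c%:Z)) (Tpow T Tinv (- (v - c%:Z)) x).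
rewrite (eq_bigr (fun m : 'I__ => if m%:Z == k0 + c%:Z then G (k0 + c%:Z) else 0)); last first.
  move=> m _; rewrite {1}/a /cpmono.
  have -> : (m%:Z - c%:Z == k0) = (m%:Z == k0 + c%:Z) by lia.
  by case: eqP => [e|_]; [rewrite /G -e|rewrite mul0r].
rewrite sum_ord_pick /G addrK; case: ifP => // /negP h.
by have := hc k0 _ x; rewrite /a /cpmono eqxx => ->; rewrite ?mul0r //; lia.
Qed.

Lemma cp_ext a b : (forall k x, a k x = b k x) -> a = b.
Proof. by move=> h; apply/funext => k; apply/funext => x. Qed.

Lemma cpmul_mono0 (f : X -> K) b : cpmul (cpmono f 0) b = fun k x => f x * b k x.
Proof. by apply: cp_ext => k x; rewrite cpmul_monoE subr0 oppr0. Qed.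

Lemma locally_constant_cst (c : K) : locally_constant (fun _ : X => c).
Proof. by move=> x; exists setT; split=> //; exact: openT. Qed.

Lemma locally_constant2 (A B C : Type) (h : A -> B -> C) (f : X -> A) (g : X -> B) :
  locally_constant f -> locally_constant g -> locally_constant (fun x => h (f x) (g x)).
Proof.
move=> lf lg x; have [U [oU Ux fU]] := lf x; have [U' [oU' Ux' fU']] := lg x.
exists (U `&` U'); split=> //; first exact: openI.
by move=> z [Uz U'z]; rewrite fU // fU'.
Qed.

Lemma locally_constant_comp (A : Type) (g : X -> X) (f : X -> A) :
  continuous g -> locally_constant f -> locally_constant (f \o g).
Proof.
move=> cg lf x; have [U [oU Ux fU]] := lf (g x); exists (g @^-1` U); split=> //.
  exact: (proj1 (continuousP _) cg).
by move=> z; exact: fU.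
Qed.

Lemma locally_constant_chi U : clopen U -> locally_constant (chi U : X -> K).
Proof.
move=> [oU cU] x; case: (pselect (U x)) => Ux.
  by exists U; split=> // z Uz; rewrite !chi1.
exists (~` U); split=> //; first exact: closed_openC.
by move=> z Uz; rewrite !chi0.
Qed.

Lemma continuous_Tpow i : continuous (Tpow T Tinv i).
Proof. by case: i => n; exact: continuous_iter. Qed.

Lemma inA_one : inA (@cpone X K).
Proof.
split; first by exists 0%N => i i0 x; rewrite /cpone; case: eqP => // e; lia.
by move=> i; rewrite /cpone; case: eqP => _; exact: locally_constant_cst.
Qed.

Lemma inA_add a b : inA a -> inA b -> inA (cpadd a b).
Proof.
move=> [[N aN] la] [[M bM] lb]; split; last by move=> i; exact: locally_constant2.
by exists (maxn N M) => i h x; rewrite /cpadd aN ?bM ?addr0 //; lia.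
Qed.

Lemma inA_scale l a : inA a -> inA (cpscale l a).
Proof.
move=> [[N aN] la]; split.
  by exists N => i h x; rewrite /cpscale aN ?mulr0.
move=> i; apply: (locally_constant2 (fun c d => c * d)) => //.
exact: locally_constant_cst.
Qed.

Lemma inA_mul a b : inA a -> inA b -> inA (cpmul a b).
Proof.
move=> [ea la] [[M bM] lb]; have ac := cbndP ea; split.
  exists (cbnd a + M)%N => k h x; rewrite /Defs.cpmul big1 // => m _ /=.
  set i := _ - _; case: (ltnP (cbnd a) `|i|) => hi; first by rewrite ac ?mul0r.
  by rewrite bM ?mulr0 //; lia.
move=> k; rewrite /Defs.cpmul.
elim: (cbnd a).*2.+1 => [|n IH].
  rewrite (_ : (fun x : X => _) = fun=> 0); first exact: locally_constant_cst.
  by apply/funext => x; rewrite big_ord0.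
rewrite (_ : (fun x : X => _) = fun x : X => \sum_(m < n)
    a (m%:Z - (cbnd a)%:Z) x * b (k - (m%:Z - (cbnd a)%:Z)) (Tpow T Tinv (- (m%:Z - (cbnd a)%:Z)) x)
  + a (n%:Z - (cbnd a)%:Z) x * b (k - (n%:Z - (cbnd a)%:Z)) (Tpow T Tinv (- (n%:Z - (cbnd a)%:Z)) x)).
  apply: (locally_constant2 (fun c d => c + d)) => //.
  apply: (locally_constant2 (fun c d => c * d)) => //.
  by apply: (locally_constant_comp (f := b _)) => //; exact: continuous_Tpow.
by apply/funext => x; rewrite big_ord_recr.
Qed.

Lemma inA_mono f k : locally_constant f -> inA (@cpmono X K f k).
Proof.
move=> lf; split; first by exists `|k|%N => i ik x; rewrite /cpmono; case: eqP => // e; lia.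
move=> i; rewrite /cpmono; case: eqP => // _; exact: locally_constant_cst.
Qed.

End CrossedProductFacts.

(** * Elements of [A_n] as families of matrices over the towers *)

Section TowerRepresentation.
Variables (R : realType) (X : pseudoMetricType R) (T Tinv : X -> X)
  (mu : set X -> R) (y : X) (E : nat -> set X) (P : nat -> set (set X)).
Hypothesis S : setup T Tinv mu y E P.
Variables (K : fieldType) (conj : {rmorphism K -> K}).
Let cT := setup_cont S.
Let cTinv := setup_contV S.

Local Notation V := (V T E P).
Local Notation wlen := (wlen T E P).
Local Notation Rn := (Rn T K E P).
Local Notation cp := (cp X K).
Local Notation cpmul := (cpmul T Tinv).
Local Notation cpstar := (cpstar T Tinv conj).
Local Notation inAn := (inAn T Tinv conj P).
Implicit Types a b : cp.

Definition Phi a : Rseq T K E P := fun m W =>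
  \matrix_(p, q) a (p%:Z - q%:Z) (iter p T (xget y W)).

Lemma xget_V n W : V n W -> W (xget y W).
Proof. by move=> /V_ne [z Wz]; exact: (xgetI _ Wz). Qed.

Lemma Phi_ord a m W p q : (p < wlen m W)%N -> (q < wlen m W)%N ->
  mget (Phi a m W) p%:Z q%:Z = a (p%:Z - q%:Z) (iter p T (xget y W)).
Proof. by move=> pk qk; rewrite (mget_ord _ (Ordinal pk) (Ordinal qk)) mxE. Qed.

(* [tower_rep n a x]: on the columns over the towers of level [n], [a] acts
   through the matrices [x W] and never leaves a column. *)
Definition tower_rep n a (x : Rn n) := forall W z p (d : int), V n W -> W z ->
  (p < wlen n W)%N -> a d (iter p T z) = mget (x W) p%:Z (p%:Z - d).

(** Criterion for the generators: no coefficient leads out of a column, and the coefficients do not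
    depend on the point chosen in the base. *)
Lemma tower_rep_Phi n a :
  (forall W z p (d : int), V n W -> W z -> (p < wlen n W)%N ->
     ~~ ((0 <= p%:Z - d) && (p%:Z - d < (wlen n W)%:Z)) -> a d (iter p T z) = 0) ->
  (forall W z z' p (d : int), V n W -> W z -> W z' -> (p < wlen n W)%N ->
     a d (iter p T z) = a d (iter p T z')) ->
  tower_rep a (Phi a n).
Proof.
move=> h0 hc W z p d VW Wz pk.
case: (boolP ((0 <= p%:Z - d) && (p%:Z - d < (wlen n W)%:Z))) => h.
  have qk : (`|p%:Z - d| < wlen n W)%N by lia.
  have -> : p%:Z - d = `|p%:Z - d|%N :> int by lia.
  rewrite Phi_ord //; have -> : p%:Z - `|p%:Z - d|%N%:Z = d by lia.
  by apply: (hc W) => //; exact: (xget_V VW).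
rewrite (h0 W) // mget_out //; apply: contra h; lia.
Qed.

Lemma tower_rep_eq n a (x : Rn n) W : tower_rep a x -> V n W -> x W = Phi a n W.
Proof.
move=> ax VW; apply/matrixP => p q; rewrite mxE (ax _ _ _ _ VW (xget_V VW) (ltn_ord p)).
by rewrite -mget_ord; congr mget; lia.
Qed.

Lemma Tpow_iter (p r : nat) z :
  Tpow T Tinv (- (p%:Z - r%:Z)) (iter p T z) = iter r T z.
Proof.
case: (leqP p r) => pr.
  have -> : - (p%:Z - r%:Z) = Posz (r - p) by lia.
  by rewrite /= -iterD subnK.
have -> : - (p%:Z - r%:Z) = Negz (p - r).-1 by rewrite NegzE; lia.
rewrite /Tpow prednK ?subn_gt0 //.
have -> : iter p T z = iter (p - r) T (iter r T z) by rewrite -iterD subnK // ltnW.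
by rewrite (iterK S).
Qed.

(** Since [a] never leaves a column, the convolution is exactly a matrix product, without boundary
    terms. *)
Lemma tower_rep_mul n a b (x x' : Rn n) : inA a -> tower_rep a x -> tower_rep b x' ->
  tower_rep (cpmul a b) (Rmul x x').
Proof.
move=> [ea _] ax bx W z p d VW Wz pk; rewrite /Rmul (mgetM _ _ (Ordinal pk)) /=.
rewrite /Defs.cpmul /=; pose G (i : int) := a i (iter p T z) * b (d - i) (Tpow T Tinv (- i) (iter p T z)).
rewrite (sum_window (G := G) (c := cbnd a) (k := wlen n W) (p := p)).
- apply: eq_bigr => r _; rewrite /G (ax _ _ _ _ VW Wz pk).
  have -> : p%:Z - (p%:Z - r%:Z) = r by lia.
  rewrite (mget_ord _ (Ordinal pk) r); congr (_ * _).
  rewrite Tpow_iter (bx _ _ _ _ VW Wz (ltn_ord r)); congr mget; lia.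
- by move=> i ic; rewrite /G cbndP ?mul0r.
- move=> i h; rewrite /G (ax _ _ _ _ VW Wz pk) mget_out ?mul0r //.
  by apply: contra h; lia.
Qed.

Lemma chi_same_cell n Z w w' : P n Z -> same_cell E P n w w' ->
  (chi Z w : K) = chi Z w'.
Proof.
move=> PZ ww'; have cZ : cell E P n Z by left.
have sym := same_cell_sym S ww'.
rewrite !chiE; congr (nat_of_bool _)%:R; apply/asboolP/asboolP; [exact: ww'|exact: sym].
Qed.

Lemma conj_chi (U : set X) x : conj (chi U x) = chi U x.
Proof. by rewrite !chiE rmorph_nat. Qed.

Lemma cpstar_genE Z : cpstar (cpmono (chi Z) 1) = cpmono (fun x => chi Z (T x)) (-1).
Proof.
apply: cp_ext => k x; rewrite /Defs.cpstar /cpmono.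
have -> : (- k == 1) = (k == -1) by lia.
by case: eqP => [->|_]; [rewrite conj_chi|rewrite rmorph0].
Qed.

Lemma inAn_inA n a : inAn n a -> inA a.
Proof.
elim=> {a} [Z PZ|Z PZ||a b _ ia _ ib|l a _ ia|a b _ ia _ ib].
- by apply/inA_mono/locally_constant_chi; case: (setup_clopenP S PZ).
- rewrite cpstar_genE; apply: inA_mono; apply: (locally_constant_comp (f := chi Z)) => //.
  by apply: locally_constant_chi; case: (setup_clopenP S PZ).
- exact: inA_one.
- exact: inA_add.
- exact: inA_scale.
- exact: inA_mul.
Qed.

Lemma inAn_tower_rep n a : inAn n a -> exists x : Rn n, tower_rep a x.
Proof.
elim=> {a} [Z PZ|Z PZ||a b _ [x ax] _ [x' bx']|l a _ [x ax]|a b ia [x ax] _ [x' bx']].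
- exists (Phi (cpmono (chi Z) 1) n); apply: tower_rep_Phi => [W z p d VW Wz pk h|W z z' p d VW Wz Wz' pk].
    (* Only the bottom row could lead out of the column, but it lies in [E n], which misses [Z]. *)
    rewrite /cpmono; case: eqP => // d1; have p0 : p = 0%N by lia.
    rewrite p0 chi0 // => Zz; apply: (PE_disj S PZ Zz).
    by case: (V_return S VW Wz).
  rewrite /cpmono; case: eqP => // _; apply: (chi_same_cell PZ).
  by apply: (V_same_cell S VW) => //; exact: ltnW.
- rewrite cpstar_genE; exists (Phi (cpmono (fun x => chi Z (T x)) (-1)) n).
  apply: tower_rep_Phi => [W z p d VW Wz pk h|W z z' p d VW Wz Wz' pk].
    (* For the adjoint only the top row is at stake, and its image under [T] is back in [E n]. *)
    rewrite /cpmono; case: eqP => // d1; have pk' : p.+1 = wlen n W by lia.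
    rewrite chi0 // -iterS pk' => Zz; apply: (PE_disj S PZ Zz).
    by case: (V_return S VW Wz).
  rewrite /cpmono; case: eqP => // _; apply: (chi_same_cell PZ).
  exact: (V_same_cell S VW (i := p.+1)).
- exists (@Rone R X T K E P n) => W z p d VW Wz pk.
  rewrite /cpone /Rone; case: mgetP => [p' q /eqP|].
    rewrite eqz_nat => /eqP pp' e; rewrite mxE -val_eqE /= -pp'.
    have -> : (p == q) = (d == 0) by lia.
    by case: eqP.
  by case: eqP => // -> ; rewrite subr0; move/negP; case; lia.
- by exists (Radd x x') => W z p d VW Wz pk; rewrite /cpadd (ax _ _ _ _ VW Wz pk) (bx' _ _ _ _ VW Wz pk) mgetD.
- by exists (fun W => l *: x W) => W z p d VW Wz pk; rewrite /cpscale (ax _ _ _ _ VW Wz pk) mgetZ.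
- by exists (Rmul x x'); apply: tower_rep_mul => //; exact: inAn_inA ia.
Qed.

(** Both matrices have the same rows on each block of level [n], so the equality is exact at every
    level [m >= n], not only up to rank. *)
Lemma tower_rep_embed n a (x : Rn n) m W : tower_rep a x -> (n <= m)%N -> V m W ->
  embed x m W = Phi a m W.
Proof.
move=> ax nm VW; have Wz := xget_V VW; apply/matrixP => q r.
have [j [W0 [VW0 W0j jq qj jk]]] := block_exists S nm VW Wz (ltn_ord q).
rewrite (embed_block S _ nm _ VW Wz VW0 W0j) ?jq // mxE.
have -> : iter q T (xget y W) = iter (q - j) T (iter j T (xget y W)).
  by rewrite -iterD subnK.
rewrite (ax _ _ _ _ VW0 W0j); last by lia.
by congr mget; lia.
Qed.

Lemma cppow_snE n i : cppow T Tinv (sn K E n) i =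
  cpmono (fun x => \prod_(l < i) chi (~` E n) (iter l Tinv x)) i.
Proof.
elim: i => [|i IH]; apply: cp_ext => k x.
  by rewrite /= /cpone /cpmono big_ord0.
rewrite [LHS](_ : _ = cpmul (sn K E n) (cppow T Tinv (sn K E n) i) k x) //.
rewrite IH /sn cpmul_monoE /cpmono.
have -> : (k - 1 == i) = (k == i.+1) by lia.
case: eqP => _; last by rewrite mulr0.
by rewrite big_ord_recl /=; congr (_ * _); apply: eq_bigr => l _; rewrite -iterSr.
Qed.

Lemma cppow_snstarE n j : cppow T Tinv (cpstar (sn K E n)) j =
  cpmono (fun x => \prod_(l < j) chi (~` E n) (iter l.+1 T x)) (- j%:Z).
Proof.
rewrite /sn cpstar_genE; elim: j => [|j IH]; apply: cp_ext => k x.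
  by rewrite /= /cpone /cpmono big_ord0.
rewrite [LHS](_ : _ = cpmul (cpmono (fun x => chi (~` E n) (T x)) (-1))
  (cppow T Tinv (cpmono (fun x => chi (~` E n) (T x)) (-1)) j) k x) //.
rewrite IH cpmul_monoE /cpmono.
have -> : (k - -1 == - j%:Z) = (k == - j.+1%:Z) by lia.
case: eqP => _; last by rewrite mulr0.
by rewrite big_ord_recl /=; congr (_ * _); apply: eq_bigr => l _; rewrite -iterSr.
Qed.

Lemma Tpow_opp i x : Tpow T Tinv (- i%:Z) x = iter i Tinv x.
Proof. by case: i => [|i]; [rewrite oppr0|rewrite -NegzE]. Qed.

(** The factors contributed by the powers of [s_n] and of its adjoint equal 1 over [W], because the
    intermediate levels of the tower avoid [E n]. *)
Lemma eWE n W i j : V n W -> (i < wlen n W)%N -> (j < wlen n W)%N ->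
  eW T Tinv conj E n W i j = cpmono (fun x => chi W (iter i Tinv x)) (i%:Z - j%:Z).
Proof.
move=> VW ik jk; rewrite /eW cppow_snE cppow_snstarE; apply: cp_ext => k x.
rewrite [cpmul (cpmono _ i) _](_ : _ = cpmono (fun x =>
   \prod_(l < i) chi (~` E n) (iter l Tinv x) * chi W (iter i Tinv x)) i); last first.
  apply: cp_ext => k' x'; rewrite cpmul_monoE Tpow_opp /cpmono.
  have -> : (k' - i%:Z == 0) = (k' == i%:Z) by lia.
  by case: eqP => _; rewrite ?mulr0.
rewrite cpmul_monoE Tpow_opp /cpmono.
have -> : (k - i%:Z == - j%:Z) = (k == i%:Z - j%:Z) by lia.
case: eqP => _; last by rewrite mulr0.
case: (pselect (W (iter i Tinv x))) => Wx; last by rewrite chi0 // mulr0 mul0r.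
have [_ _ _ nE] := V_return S VW Wx.
rewrite chi1 // mulr1 [X in X * _]big1 ?mul1r => [|l _]; last first.
  rewrite chi1 //=; have := nE (i - l)%N.
  have -> : iter (i - l) T (iter i Tinv x) = iter l Tinv x.
    by rewrite -[in iter i Tinv x](subnK (ltnW (ltn_ord l))) iterD (iterVK S).
  by apply; have := ltn_ord l; lia.
by rewrite big1 // => l _; rewrite chi1 //=; apply: (nE l.+1); have := ltn_ord l; lia.
Qed.

(** The element of the crossed product with matrix [x W] on the tower over [W] and 0 elsewhere; it
    is the right-hand side of [pi_rel]. *)
Definition tower_elt n W (x : Rn n) : cp :=
  cpsum (enum 'I_(wlen n W)) (fun i => cpsum (enum 'I_(wlen n W)) (fun j =>
    cpscale (x W i j) (eW T Tinv conj E n W i j))).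

Lemma tower_elt_in n W (x : Rn n) z p d : V n W -> W z -> (p < wlen n W)%N ->
  tower_elt W x d (iter p T z) = mget (x W) p%:Z (p%:Z - d).
Proof.
move=> VW Wz pk; rewrite /tower_elt cpsumE big_enum /mget; apply: eq_bigr => i _.
rewrite cpsumE big_enum; apply: eq_bigr => j _ /=.
rewrite /cpscale eWE // /cpmono; congr (_ * _).
have -> : chi W (iter i Tinv (iter p T z)) = (i == p :> nat)%:R :> K.
  case: eqP => [->|ip]; first by rewrite (iterK S) chi1.
  rewrite chi0 // => Wi; apply: ip.
  have [] // := tower_uniq S (q := i) (q' := p) VW VW Wi Wz (ltn_ord i) pk.
  by rewrite (iterVK S).
rewrite eqz_nat; case: (eqVneq (i : nat) p) => [->|_] /=; last by case: eqP.
have -> : (d == p%:Z - j%:Z) = (j%:Z == p%:Z - d) by lia.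
by case: eqP.
Qed.

Lemma tower_elt_out n W (x : Rn n) d w : V n W ->
  (forall p z, W z -> (p < wlen n W)%N -> w <> iter p T z) -> tower_elt W x d w = 0.
Proof.
move=> VW h; rewrite /tower_elt cpsumE big1 // => i _; rewrite cpsumE big1 // => j _.
rewrite /cpscale eWE // /cpmono; case: eqP => _; rewrite ?mulr0 // chi0 ?mulr0 // => Wi.
by apply: (h i _ Wi (ltn_ord i)); rewrite (iterVK S).
Qed.

Lemma cpmul_hW n W a k x : cpmul (hW T K E P n W) a k x =
  (\sum_(l < wlen n W) chi (iter l T @` W) x) * a k x.
Proof.
rewrite (_ : hW T K E P n W = cpmono (fun x => \sum_(l < wlen n W) chi (iter l T @` W) x) 0).
  by rewrite cpmul_mono0.
apply: cp_ext => k' x'; rewrite /hW cpsumE.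
transitivity (\sum_(0 <= l < wlen n W) @cpmono X K (chi (iter l T @` W)) 0 k' x').
  by rewrite /index_iota subn0.
rewrite big_mkord /cpmono.
by case: eqP => // _; rewrite big1.
Qed.

Lemma hW_in n W z p : V n W -> W z -> (p < wlen n W)%N ->
  \sum_(l < wlen n W) chi (iter l T @` W) (iter p T z) = 1 :> K.
Proof.
move=> VW Wz pk; rewrite (bigD1 (Ordinal pk)) //= chi1 ?big1 ?addr0 //.
move=> l lp; rewrite chi0 // => -[z' Wz' e].
have [e' _ _] := tower_uniq S (q := l) (q' := p) VW VW Wz' Wz (ltn_ord l) pk e.
by case/eqP: lp; apply: val_inj.
Qed.

(** Multiplication by [hW n W] restricts coefficients to the tower over [W], so both conditions
    compare the same values, on the tower and off it. *)
Lemma pi_relP n a (x : Rn n) : pi_rel Tinv conj a x <-> tower_rep a x.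
Proof.
split=> [ax W z p d VW Wz pk|ax W VW].
  rewrite -(tower_elt_in x d VW Wz pk) /tower_elt -(ax W VW) cpmul_hW.
  by rewrite hW_in // mul1r.
rewrite -/(tower_elt W x); apply: cp_ext => d w; rewrite cpmul_hW.
case: (pselect (exists p z, [/\ W z, (p < wlen n W)%N & w = iter p T z])).
  move=> [p [z [Wz pk ->]]]; rewrite hW_in // mul1r tower_elt_in //.
  exact: ax.
move=> nw; rewrite tower_elt_out //; last by move=> p z Wz pk e; apply: nw; exists p, z.
rewrite big1 ?mul0r // => l _; rewrite chi0 // => -[z Wz e]; apply: nw.
by exists l, z; split=> //; exact: ltn_ord.
Qed.

End TowerRepresentation.

(** * The matrix units of the towers belong to [A_n] *)

Section Generation.
Variables (R : realType) (X : pseudoMetricType R) (T Tinv : X -> X)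
  (mu : set X -> R) (y : X) (E : nat -> set X) (P : nat -> set (set X)).
Hypothesis S : setup T Tinv mu y E P.
Variables (K : fieldType) (conj : {rmorphism K -> K}).
Let TinvK := setup_TVK S.

Local Notation V := (V T E P).
Local Notation wlen := (wlen T E P).
Local Notation Rn := (Rn T K E P).
Local Notation cp := (cp X K).
Local Notation cpmul := (cpmul T Tinv).
Local Notation cpstar := (cpstar T Tinv conj).
Local Notation inAn := (inAn T Tinv conj P).

Lemma inAn_sum n (I : eqType) (r : seq I) (F : I -> cp) :
  (forall i, i \in r -> inAn n (F i)) -> inAn n (cpsum r F).
Proof.
elim: r => [|i r IH] Fr /=.
  rewrite (_ : @cpzero X K = cpscale 0 (@cpone X K)).
    by apply: An_scale; exact: An_one.
  by apply: cp_ext => k x; rewrite /cpscale mul0r.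
apply: An_add; first by apply: Fr; rewrite mem_head.
by apply: IH => j jr; apply: Fr; rewrite in_cons jr orbT.
Qed.

Lemma inAn_pow n (a : cp) i : inAn n a -> inAn n (cppow T Tinv a i).
Proof. by move=> an; elim: i => [|i IH] /=; [exact: An_one|exact: An_mul]. Qed.

Let atoms n := finmap.enum_fset (fset_set (P n)).

Lemma mem_atoms n Z : (Z \in atoms n) = (Z \in P n).
Proof. by exact: (in_fset_set (setup_finP S n)). Qed.

Lemma sum_chi_atoms n w : \sum_(Z <- atoms n) chi Z w = chi (~` E n) w :> K.
Proof.
have ua : uniq (atoms n) by exact: finmap.fset_uniq.
case: (pselect (E n w)) => Ew.
  rewrite chi0 => [|/(_ Ew)//]; rewrite big_seq big1 // => Z.
  by rewrite mem_atoms inE => PZ; rewrite chi0 // => Zw; exact: (PE_disj S PZ Zw).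
rewrite chi1 //; have : (~` E n) w by []; rewrite -(setup_covP S) => -[Z PZ Zw].
rewrite (bigD1_seq Z) //=; last by rewrite mem_atoms inE.
rewrite chi1 // big_seq_cond big1 ?addr0 // => Z' /andP[].
rewrite mem_atoms inE => PZ' /eqP Z'Z; rewrite chi0 // => Z'w; apply: Z'Z.
by apply: (setup_disjP S PZ' PZ); exists w.
Qed.

Lemma inAn_sn n : inAn n (sn K E n).
Proof.
rewrite (_ : sn K E n = cpsum (atoms n) (fun Z => cpmono (chi Z) 1)).
  by apply: inAn_sum => Z; rewrite mem_atoms inE => PZ; exact: An_gen.
apply: cp_ext => k x; rewrite cpsumE /sn /cpmono; case: eqP => _.
  by rewrite sum_chi_atoms.
by rewrite big1.
Qed.

Lemma inAn_snstar n : inAn n (cpstar (sn K E n)).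
Proof.
rewrite (_ : cpstar _ = cpsum (atoms n) (fun Z => cpstar (cpmono (chi Z) 1))).
  by apply: inAn_sum => Z; rewrite mem_atoms inE => PZ; exact: An_genstar.
apply: cp_ext => k x; rewrite cpsumE /sn cpstar_genE.
rewrite (eq_bigr (fun Z => @cpmono X K (fun x => chi Z (T x)) (-1) k x)); last first.
  by move=> Z _; rewrite cpstar_genE.
rewrite /cpmono; case: eqP => _; first by rewrite sum_chi_atoms.
by rewrite big1.
Qed.

Lemma chiI (A B : set X) x : chi (A `&` B) x = chi A x * chi B x :> K.
Proof.
by rewrite !chiE -natrM mulnb -asbool_and.
Qed.

Lemma chiC (A : set X) x : chi (~` A) x = 1 - chi A x :> K.
Proof.
by rewrite !chiE /setC /mkset asbool_neg; case: asbool; rewrite ?subr0 ?subrr.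
Qed.

Lemma inAn_chiC n A : inAn n (cpmono (chi A) 0) -> inAn n (cpmono (chi (~` A)) 0).
Proof.
move=> iA; rewrite (_ : cpmono _ _ = cpadd (@cpone X K) (cpscale (-1) (cpmono (chi A) 0))).
  by apply: An_add; [exact: An_one|exact: An_scale].
apply: cp_ext => k x; rewrite /cpadd /cpscale /cpone /cpmono.
by case: eqP => _; rewrite ?mulr0 ?addr0 // chiC mulN1r.
Qed.

(** Conjugating [chi A] by the generator attached to [Z] pulls it back by [T]. *)
Lemma inAn_chi_preimage n Z A : P n Z -> inAn n (cpmono (chi A) 0) ->
  inAn n (cpmono (chi (T @^-1` (Z `&` A))) 0).
Proof.
move=> PZ iA; rewrite (_ : cpmono _ _ =
   cpmul (cpmul (cpstar (cpmono (chi Z) 1)) (cpmono (chi A) 0)) (cpmono (chi Z) 1)).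
  by apply: An_mul; [apply: An_mul => //; exact: An_genstar|exact: An_gen].
apply: cp_ext => k x; rewrite cpstar_genE.
rewrite [cpmul _ (cpmono (chi A) 0)](_ : _ = cpmono (fun x => chi Z (T x) * chi A (T x)) (-1)); last first.
  apply: cp_ext => k' x'; rewrite cpmul_monoE /cpmono opprK /=.
  have -> : (k' - -1 == 0) = (k' == -1) by lia.
  by case: eqP => _; rewrite ?mulr0.
rewrite cpmul_monoE /cpmono opprK /=.
have -> : (k - -1 == 1) = (k == 0) by lia.
case: eqP => _; last by rewrite mulr0.
by rewrite (_ : chi (T @^-1` _) x = chi (Z `&` A) (T x)) // chiI [RHS]mulrAC -[X in _ = X * _]chiI setIid.
Qed.

Lemma inAn_chi_sum_preimage n (F : set X -> set X) :
  (forall Z, P n Z -> inAn n (cpmono (chi (F Z)) 0)) ->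
  inAn n (cpmono (fun x => \sum_(Z <- atoms n) chi (F Z) x) 0).
Proof.
move=> FP; rewrite (_ : cpmono _ _ = cpsum (atoms n) (fun Z => cpmono (chi (F Z)) 0)).
  by apply: inAn_sum => Z; rewrite mem_atoms inE => /FP.
by apply: cp_ext => k x; rewrite cpsumE /cpmono; case: eqP => _ //; rewrite big1.
Qed.

(** The complement of [E n] is the disjoint union of the atoms [Z], and each [chi Z] is a generator
    times its adjoint. *)
Lemma inAn_chi_E n : inAn n (cpmono (chi (E n)) 0).
Proof.
rewrite -[E n]setCK; apply: inAn_chiC.
rewrite (_ : cpmono _ _ = cpmono (fun x => \sum_(Z <- atoms n) chi Z x) 0).
  apply: (inAn_chi_sum_preimage (F := id)) => Z PZ.
  rewrite (_ : cpmono _ _ = cpmul (cpmono (chi Z) 1) (cpstar (cpmono (chi Z) 1))).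
    by apply: An_mul; [exact: An_gen|exact: An_genstar].
  apply: cp_ext => k x; rewrite cpmul_monoE cpstar_genE /cpmono /= TinvK.
  have -> : (k - 1 == -1) = (k == 0) by lia.
  by case: eqP => _; rewrite ?mulr0 // -chiI setIid.
by congr cpmono; apply/funext => x; rewrite sum_chi_atoms.
Qed.

Lemma inAn_chi_preimage_E n : inAn n (cpmono (chi (T @^-1` E n)) 0).
Proof.
rewrite -[T @^-1` _]setCK; apply: inAn_chiC.
rewrite (_ : cpmono _ _ = cpmono (fun x => \sum_(Z <- atoms n) chi (T @^-1` (Z `&` setT)) x) 0).
  apply: (inAn_chi_sum_preimage (F := fun Z => T @^-1` (Z `&` setT))) => Z PZ.
  apply: inAn_chi_preimage => //.
  rewrite (_ : cpmono _ _ = @cpone X K); first exact: An_one.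
  by apply: cp_ext => k x; rewrite /cpmono chi1.
congr cpmono; apply/funext => x.
rewrite (_ : chi _ x = chi (~` E n) (T x)) // -sum_chi_atoms.
by apply: eq_bigr => Z _; rewrite setIT.
Qed.

(** Induction on the length of the word: the first letter is peeled off with [inAn_chi_preimage],
    and the remaining word is shifted by one. *)
Lemma inAn_chi_return n k (Zs : nat -> set X) :
  (forall i, (0 < i < k.+1)%N -> P n (Zs i)) ->
  inAn n (cpmono (chi [set x | (forall i, (0 < i < k.+1)%N -> Zs i (iter i T x)) /\
                               E n (iter k.+1 T x)]) 0).
Proof.
elim: k Zs => [|k IH] Zs PZs.
  rewrite (_ : mkset _ = T @^-1` E n); first exact: inAn_chi_preimage_E.
  by apply/seteqP; split=> x /=; [case|move=> Ex; split=> // i; lia].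
have PZs' i : (0 < i < k.+1)%N -> P n (Zs i.+1) by move=> ik; apply: PZs; lia.
have := inAn_chi_preimage (PZs 1%N isT) (IH (fun i => Zs i.+1) PZs').
congr (inAn n (cpmono (chi _) 0)); apply/seteqP; split=> x /=.
  move=> [Z1 [Zi Ek]]; split; last by rewrite -iterSr in Ek.
  move=> [|[|i]] // ik; rewrite iterSr; apply: Zi; lia.
move=> [Zi Ek]; split; first exact: (Zi 1%N).
split; last by rewrite -iterSr.
by move=> i ik; rewrite -iterSr; apply: Zi; lia.
Qed.

Lemma inAn_chi_V n W : V n W -> inAn n (cpmono (chi W) 0).
Proof.
move=> [[|k] [// _ [Zs [PZs WE]] _]].
have := An_mul (inAn_chi_E n) (inAn_chi_return PZs).
congr (inAn n _); apply: cp_ext => j x; rewrite cpmul_mono0 /cpmono.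
case: eqP => _; last by rewrite mulr0.
by rewrite -chiI WE; congr (chi _ x); apply/seteqP; split=> z /=; [case=> ? []|case].
Qed.

Lemma inAn_tower_elt n W (x : Rn n) : V n W -> inAn n (tower_elt Tinv conj W x).
Proof.
move=> VW; apply: inAn_sum => i _; apply: inAn_sum => j _; apply: An_scale.
apply: An_mul; last by apply: inAn_pow; exact: inAn_snstar.
by apply: An_mul; [apply: inAn_pow; exact: inAn_sn|exact: inAn_chi_V].
Qed.

End Generation.

(** * The map [Phi] *)

Section Embedding.
Variables (R : realType) (X : pseudoMetricType R) (T Tinv : X -> X)
  (mu : set X -> R) (y : X) (E : nat -> set X) (P : nat -> set (set X)).
Hypothesis S : setup T Tinv mu y E P.
Variables (K : fieldType) (conj : {rmorphism K -> K}).
Let cT := setup_cont S.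
Let cTinv := setup_contV S.
Let mu_prob := setup_prob S.

Local Notation V := (V T E P).
Local Notation wlen := (wlen T E P).
Local Notation Rn := (Rn T K E P).
Local Notation Rseq := (Rseq T K E P).
Local Notation cp := (cp X K).
Local Notation cpmul := (cpmul T Tinv).
Local Notation inAn := (inAn T Tinv conj P).
Local Notation Phi := (Phi T y E P).
Implicit Types a b : cp.

Lemma borel_boundary N n : borel_set (boundary T Tinv E N n).
Proof. by apply: borel_clopen; exact: (clopen_boundary S). Qed.

Lemma rkn_lt n (x : Rn n) B e : borel_set B -> mu B < e ->
  (forall W z (q r : 'I_(wlen n W)), V n W -> W z -> x W q r != 0 -> B (iter q T z)) ->
  (rkn mu x < e%:E)%E.
Proof. by move=> bB Be h; apply: le_lt_trans (rkn_le S bB h) _; rewrite lte_fin. Qed.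

Lemma rkn_eq0_lt n (x : Rn n) e : 0 < e -> (forall W, V n W -> x W = 0) ->
  (rkn mu x < e%:E)%E.
Proof.
move=> e0 x0; have [mu0 _ _ _] := mu_prob.
apply: (@rkn_lt n x set0 e); [exact: borel_set0|by rewrite mu0|].
by move=> W z q r VW _; rewrite x0 // mxE eqxx.
Qed.

Lemma Req_eventually (u v : Rseq) n :
  (forall m W, (n <= m)%N -> V m W -> u m W = v m W) -> Req mu u v.
Proof.
move=> uv e e0; exists n => m nm; apply: rkn_eq0_lt => // W VW.
by rewrite /Rsub uv // subrr.
Qed.

Lemma Req_sym (u v : Rseq) : Req mu u v -> Req mu v u.
Proof.
by move=> uv e /uv [M hM]; exists M => m /hM; rewrite rkn_subC.
Qed.

(** The base of the tower and the image under [T] of its top both lie in [E n]. *)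
Lemma boundary_far N n W z q : V n W -> W z -> (q < wlen n W)%N ->
  ~ boundary T Tinv E N n (iter q T z) -> (N < q)%N /\ (N < wlen n W - q)%N.
Proof.
move=> VW Wz qk nB; have [Ez Ek _ _] := V_return S VW Wz; split; rewrite ltnNge; apply/negP => h; apply: nB.
  by exists q; rewrite ?ltnS //; right; rewrite /= (iterK S).
exists (wlen n W - q)%N; rewrite ?ltnS //; left.
by rewrite /= -iterD subnK // ltnW.
Qed.

(** Away from the boundary, every degree in the support of [a] keeps the row inside the tower, so
    [sum_window] identifies the convolution with the matrix product. *)
Lemma Phi_mul_boundary a b m W z (q r : 'I_(wlen m W)) : inA a -> V m W -> W z ->
  Rsub (Phi (cpmul a b) m) (Rmul (Phi a m) (Phi b m)) W q r != 0 ->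
  boundary T Tinv E (cbnd a) m (iter q T z).
Proof.
move=> [/cbndP ac _] VW Wz; apply: contraNP => nB; apply/eqP.
have [Nq Nk] := boundary_far VW Wz (ltn_ord q) nB.
rewrite /Rsub /Rmul !mxE.
set w := iter q T _; pose G (i : int) := a i w * b (q%:Z - r%:Z - i) (Tpow T Tinv (- i) w).
apply/eqP; rewrite subr_eq0; apply/eqP.
rewrite /Defs.cpmul /= (sum_window (G := G) (c := cbnd a) (k := wlen m W) (p := q)).
- apply: eq_bigr => s _; rewrite /G !mxE /w (Tpow_iter S); congr (_ * b _ _); lia.
- by move=> i ic; rewrite /G ac ?mul0r.
- by move=> i h; rewrite /G ac ?mul0r //; move: h; have := ltn_ord q; lia.
Qed.

Lemma Phi_mul a b : inA a -> Req mu (Phi (cpmul a b)) (RRmul (Phi a) (Phi b)).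
Proof.
move=> ia e e0; have [M hM] := mu_boundary_small S (cbnd a) e0.
exists M => m /hM muB; apply: (rkn_lt (@borel_boundary _ _) muB).
by move=> W z q r VW Wz; exact: Phi_mul_boundary.
Qed.

Lemma Phi_add a b m : Phi (cpadd a b) m = Radd (Phi a m) (Phi b m).
Proof.
apply: functional_extensionality_dep => W.
by apply/matrixP => p q; rewrite !mxE.
Qed.

Lemma Phi_scale l a m : Phi (cpscale l a) m = fun W => l *: Phi a m W.
Proof.
apply: functional_extensionality_dep => W.
by apply/matrixP => p q; rewrite !mxE.
Qed.

Lemma Phi_one m : Phi (@cpone X K) m = @Rone R X T K E P m.
Proof.
apply: functional_extensionality_dep => W.
apply/matrixP => p q; rewrite !mxE /cpone -val_eqE /= subr_eq0 eqz_nat.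
by case: eqP.
Qed.

Lemma inA_same_cell a : inA a -> exists M, forall n i x z, (M <= n)%N ->
  same_cell E P n x z -> a i x = a i z.
Proof.
move=> [[N aN] la].
have mod_i i := locally_constant_same_cell S (la i).
have [f hf] := boolp.choice mod_i.
(* The largest of the levels obtained for the [2 N + 1] degrees that may carry a nonzero
   coefficient. *)
exists (\max_(j < N.*2.+1) f (j%:Z - N%:Z)%R)%N => n i x z fn xz.
case: (ltnP N `|i|) => iN; first by rewrite !aN.
apply: (hf i n) => //; apply: leq_trans fn.
have jlt : (`|(i + N%:Z)%R| < N.*2.+1)%N by lia.
apply: leq_trans (leq_bigmax (Ordinal jlt)) => /=.
by have -> : `|(i + N%:Z)%R|%N%:Z - N%:Z = i by lia.
Qed.

(** The matrix of level [d + n] is compared with the block diagonal one coming from level [n]: they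
    can only differ on rows within [N] steps of [E n]. *)
Lemma Phi_cauchy a : inA a -> rk_cauchy mu (Phi a).
Proof.
move=> ia e e0; have [M0 hM0] := inA_same_cell ia; have [[N aN] la] := ia.
have [M1 hM1] := mu_boundary_small S N e0.
exists (maxn M0 M1) => n; rewrite geq_max => /andP[nM0 /hM1 nM1] d.
apply: (rkn_lt (@borel_boundary _ _) nM1).
move=> W z q r VW Wz; apply: contraNP => nB; rewrite /Rsub !mxE subr_eq0; apply/eqP.
have [j [W0 [VW0 W0j jq qj jk]]] := block_exists S (leq_addl d n) VW Wz (ltn_ord q).
rewrite (jup_block S _ _ VW Wz VW0 W0j) ?jq // /=.
have qj' : (q - j < wlen n W0)%N by lia.
have qE : iter q T z = iter (q - j) T (iter j T z) by rewrite -iterD subnK.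
have [] := boundary_far (N := N) VW0 W0j qj'; first by rewrite -qE.
(* Outside the band of width [N] both entries vanish; inside it the column stays in the block of the
   row. *)
move=> Nq Nk; case: (ltnP N `|q%:Z - r%:Z|) => qr.
  rewrite aN //; case: mgetP => // p s ep es; rewrite mxE aN //; lia.
have -> : q%:Z - j%:Z = (q - j)%N by lia.
have rjlt : (r - j < wlen n W0)%N by lia.
have -> : r%:Z - j%:Z = (r - j)%N by lia.
rewrite Phi_ord //.
have -> : (q - j)%N%:Z - (r - j)%N%:Z = q%:Z - r%:Z by lia.
(* The two entries use different base points; both are compared with the orbit of [z], through the
   tower over [W0] and through that over [W]. *)
apply: (hM0 n) => //; apply: (@same_cell_trans _ _ _ _ _ _ (iter q T z)).
  rewrite qE; apply: (V_same_cell S VW0) => //; [exact: xget_V VW0|exact: ltnW].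
apply: (same_cell_le S (leq_addl d n)).
by apply: (V_same_cell S VW) => //; [exact: xget_V VW|exact: ltnW].
Qed.

Lemma aperiodic_nbhd N x : (forall j, (0 < j <= N)%N -> iter j T x <> x) ->
  exists U, [/\ open U, U x & forall j z, (0 < j <= N)%N -> U z -> ~ U (iter j T z)].
Proof.
elim: N => [|N IH] xN; first by exists setT; split=> //; [exact: openT|move=> j z; lia].
have [j jN|U [oU Ux hU]] := IH; first by apply: xN; lia.
have [U' [oU' U'x hU']] := moved_nbhd (setup_hausdorff S) cT (xN N.+1 (leqnn _)).
exists (U `&` U'); split=> //; first exact: openI.
move=> j z; rewrite (leq_eqVlt j) => /andP[j0 /orP[/eqP ->|jN]] [Uz U'z] [Uz' U'z'].
  exact: (hU' z).
by apply: (hU j z) => //; rewrite j0.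
Qed.

(** Row [p] is paired with column [p - i0], where the entry is [c]. A nonzero entry at row [p] and
    column [p' - i0] forces [p] and [p'] to differ by at most [N + |i0|], which the separation of
    the iterates of [U] excludes unless [p = p']. *)
Lemma Phi_rank_ge m a i0 N c (U : set X) W :
  (forall i : int, (N < `|i|)%N -> forall x, a i x = 0) -> c != 0 ->
  (forall x, U x -> a i0 x = c) ->
  (forall j z, (0 < j <= N + `|i0|)%N -> U z -> ~ U (iter j T z)) ->
  (forall x z, same_cell E P m x z -> U x -> U z) -> V m W ->
  (#|[pred p : 'I_(wlen m W) | `[< exists2 z, W z &
      (U `\` boundary T Tinv E `|i0| m) (iter p T z) >]]| <= \rank (Phi a m W))%N.
Proof.
move=> aN c0 aU Umove Usat VW.
have Wx := xget_V y VW; set x := xget y W in Wx *.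
have inS (p : 'I_(wlen m W)) : `[< exists2 z, W z &
    (U `\` boundary T Tinv E `|i0| m) (iter p T z) >] ->
    [/\ U (iter p T x), (`|i0| < p)%N & (`|i0| < wlen m W - p)%N].
  move=> /asboolP [z Wz [Uz nB]]; have [h1 h2] := boundary_far VW Wz (ltn_ord p) nB.
  split=> //; apply: Usat Uz; apply: (V_same_cell S VW) => //; exact: ltnW.
(* The boundary has been removed, so [p - i0] is a valid column and [insubd] does not return its
   default. *)
apply: (mxrank_ge_diag (g := fun p => insubd p `|p%:Z - i0|%N)) => [p /inS [Up p1 p2]|].
  rewrite mxE val_insubd; case: ifP => [_|/negP]; last by case; lia.
  have -> : p%:Z - `|p%:Z - i0|%N%:Z = i0 by lia.
  by rewrite aU.
move=> p p' /inS [Up p1 p2] /inS [Up' p1' p2'] pp'.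
rewrite mxE val_insubd; case: ifP => [_|/negP]; last by case; lia.
have -> : p%:Z - `|p'%:Z - i0|%N%:Z = p%:Z - p'%:Z + i0 by lia.
case: (ltnP N `|p%:Z - p'%:Z + i0|) => h; first by rewrite aN.
have pne : (p : nat) <> p' by move=> e; case/eqP: pp'; exact: val_inj.
exfalso; case: (ltnP p p') => lpp.
  apply: (Umove (p' - p)%N (iter p T x) _ Up); first by lia.
  by rewrite -iterD subnK // ltnW.
apply: (Umove (p - p')%N (iter p' T x) _ Up'); first by lia.
by rewrite -iterD subnK.
Qed.

Lemma Phi_faithful a : inA a -> rk_null mu (Phi a) -> a = @cpzero X K.
Proof.
move=> [[N aN] la] null; apply: contrapT => a0.
have [i0 [x0 ax0]] : exists i x, a i x <> 0.
  apply: contrapT => h; apply: a0; apply: cp_ext => i x; apply: contrapT => ne.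
  by apply: h; exists i, x.
have [D [oD Dx0 aD]] := la i0 x0.
have [x Dx aper] := aperiodic_point (setup_hausdorff S) (setup_infinite S) (clopen_basis S)
  cT (setup_TK S) mu_prob (setup_full S) (setup_erg S) (N + `|i0|) oD (ex_intro _ x0 Dx0).
have [U1 [oU1 U1x U1move]] := aperiodic_nbhd aper.
have DUx : (D `&` U1) x by [].
have [n0 cellU] := same_cell_nbhd S (openI oD oU1) DUx.
pose U := [set z | same_cell E P n0 x z].
have cU : clopen U := same_cell_clopen S n0 x.
have U0 : 0 < mu U by apply: (setup_full S); [case: cU|exists x => B].
(* One half of [mu U] absorbs the boundary; the remaining half contradicts the smallness of the
   rank. *)
have e0 : 0 < mu U / 2 by lra.
have [M1 hM1] := mu_boundary_small S `|i0| e0.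
have [M2 hM2] := null _ e0.
(* The bound [n0 <= m] makes [U] a union of cells of level [m]. *)
pose m := maxn n0 (maxn M1 M2).
have /hM1 muB : (M1 <= m)%N by rewrite /m; lia.
have /hM2 : (M2 <= m)%N by rewrite /m; lia.
apply/negP; rewrite -leNgt.
have bU := borel_clopen cU; have bB := borel_boundary `|i0| m.
apply: le_trans (_ : (mu (U `\` boundary T Tinv E `|i0| m))%:E <= _)%E.
  rewrite lee_fin; have : mu U <= mu (boundary T Tinv E `|i0| m) + mu (U `\` boundary T Tinv E `|i0| m).
    apply: le_trans (probU_le mu_prob bB (borel_setD bU bB)).
    apply: prob_le => //; first by apply: borel_setU => //; exact: borel_setD.
    by move=> z Uz; case: (pselect (boundary T Tinv E `|i0| m z)); [left|right].
  lra.
apply: (rkn_ge S); first exact: borel_setD.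
move=> W VW; apply: (Phi_rank_ge (N := N) (c := a i0 x0)) => //; first exact/eqP.
- by move=> z /cellU [/aD].
- by move=> j z jN /cellU [_ U1z] /cellU [_]; exact: U1move.
- move=> w z wz xw; apply: same_cell_trans xw _.
  by apply: (same_cell_le S _ wz); rewrite /m leq_maxl.
Qed.

(** The two elements differ by [chi (E n)] times [t], which only affects rows lying in [E n]. *)
Lemma Phi_sn_dist n m e : (n <= m)%N -> mu (E n) < e ->
  (rkn mu (Rsub (Phi (sn K E n) m) (Phi (cpt K) m)) < e%:E)%E.
Proof.
move=> nm muE; apply: (rkn_lt (borel_clopen (setup_clopenE S n)) muE).
move=> W z q r VW Wz; rewrite /Rsub !mxE /sn /cpt /cpmono.
case: (q%:Z - r%:Z == 1); last by rewrite subrr eqxx.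
apply: contraNP => nE; rewrite chi1 ?subrr // => Ew; apply: nE.
apply: (same_cell_E _ Ew); apply: (same_cell_le S nm).
by apply: (V_same_cell S VW) => //; [exact: xget_V VW|exact: ltnW].
Qed.

Lemma mu_E_small e : 0 < e -> exists M, forall m, (M <= m)%N -> mu (E m) < e.
Proof.
move=> /(mu_boundary_small S 0) [M hM]; exists M => m /hM; apply: le_lt_trans.
apply: prob_le => //; [by apply: borel_clopen; exact: (setup_clopenE S)|exact: borel_boundary|].
by move=> w Ew; exists 0%N => //; left.
Qed.

Lemma cpmul_t : cpmul (cpt K) (cpmono (fun=> 1) (-1)) = @cpone X K.
Proof.
apply: cp_ext => k x; rewrite cpmul_monoE mul1r /cpmono /cpone.
by have -> : (k - 1 == -1) = (k == 0) by lia.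
Qed.

Lemma cpmul_tV : cpmul (cpmono (fun=> 1) (-1)) (cpt K) = @cpone X K.
Proof.
apply: cp_ext => k x; rewrite cpmul_monoE mul1r /cpt /cpmono /cpone.
by have -> : (k - -1 == 1) = (k == 0) by lia.
Qed.

Lemma Phi_dense (u : Rseq) (e : R) : rk_cauchy mu u -> 0 < e ->
  exists n a, inAn n a /\ forall m, (n <= m)%N -> (rkn mu (Rsub (Phi a m) (u m)) < e%:E)%E.
Proof.
move=> cu e0; have e2 : 0 < e / 2 by lra.
(* One half of [e] pays for replacing [u] by its term of level [n], the other for discarding the
   towers higher than [L]. *)
have [n hn] := cu _ e2; have [L [G [bG muG coverG]]] := towers_cover S n e2.
pose F := [set W | V n W /\ (wlen n W <= L)%N].
pose s := finmap.enum_fset (fset_set F).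
have us : uniq s by exact: finmap.fset_uniq.
have sF W : (W \in s) = (W \in F) by exact: (in_fset_set (short_towers_finite S n L)).
pose a := cpsum s (fun W => tower_elt Tinv conj W (u n)).
have aE W z p d : V n W -> (wlen n W <= L)%N -> W z -> (p < wlen n W)%N ->
    a d (iter p T z) = mget (u n W) p%:Z (p%:Z - d).
  move=> VW WL Wz pk; rewrite /a cpsumE (bigD1_seq W) //=; last by rewrite sF inE.
  rewrite (tower_elt_in S) // big_seq_cond big1 ?addr0 // => W1 /andP[].
  rewrite sF inE => -[VW1 _] /eqP W1W; apply: (tower_elt_out S) => // q z1 W1z1 qk e1.
  by apply: W1W; have [_ _ ->] := tower_uniq S VW VW1 Wz W1z1 pk qk e1.
have sV W : W \in s -> V n W by rewrite sF inE => -[].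
pose Q W := iota 0 (wlen n W).
have QE W q : (q \in Q W) = (q < wlen n W)%N by rewrite mem_iota.
have [bC _] := mu_levels S us sV (fun W => iota_uniq 0 (wlen n W)) (fun W q => eqbLR (QE W q)).
pose C := levels Tinv s Q.
have muC : mu (~` C) < e / 2.
  apply: le_lt_trans muG; apply: prob_le => //; try exact: borel_setC.
  move=> w nC Gw; apply: nC; have [W [z [q [VW WL Wz qk ->]]]] := coverG _ Gw.
  exists W, q; split; [by rewrite sF inE|by rewrite QE|].
  by apply/(levelP S); exists z.
exists n, a; split.
  by apply: inAn_sum => W; rewrite sF inE => -[VW _]; exact: (inAn_tower_elt S).
move=> m nm; rewrite -(subnK nm); move: (m - n)%N => d.
pose v := jup d (u n).
have -> : Rsub (Phi a (d + n)%N) (u (d + n)%N) =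
    Radd (Rsub (Phi a (d + n)%N) v) (Rsub v (u (d + n)%N)).
  apply: functional_extensionality_dep => W; rewrite /Radd /Rsub.
  by rewrite addrA subrK.
apply: le_lt_trans (rkn_add_le S _ _) _.
have -> : e%:E = ((e / 2)%:E + (e / 2)%:E)%E by rewrite -EFinD -splitr.
apply: lteD; last exact: hn.
apply: (rkn_lt (borel_setC bC) muC).
(* On a row inside [C] the block of level [n] has height at most [L], and there [a] has exactly the
   matrix of [u n]. *)
move=> W z q r VW Wz; apply: contraNP => /contrapT [W1 [p [W1s p1]]].
move=> /(levelP S) [z1 W1z1 e1]; rewrite QE in p1.
have [j [W0 [VW0 W0j jq qj jk]]] := block_exists S (leq_addl d n) VW Wz (ltn_ord q).
have W0L : (wlen n W0 <= L)%N.
  have qE : iter q T z = iter (q - j) T (iter j T z) by rewrite -iterD subnK.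
  have [||_ _ ->] := tower_uniq S (q := (q - j)%N) (q' := p) VW0 (sV _ W1s) W0j W1z1 _ p1.
  - by lia.
  - by rewrite -qE.
  - by move: W1s; rewrite sF inE => -[].
(* [Phi] is evaluated at the chosen point of [W] instead of [z], so the block is transported to that
   point. *)
have Wx := xget_V y VW.
have W0x : W0 (iter j T (xget y W)).
  by apply: (image_tower_sub S (leq_addl d n) VW Wz VW0 W0j jk); exists (xget y W).
rewrite /Rsub !mxE subr_eq0 (jup_block S _ _ VW Wx VW0 W0x) ?jq //.
have -> : iter q T (xget y W) = iter (q - j) T (iter j T (xget y W)).
  by rewrite -iterD subnK.
rewrite (aE W0) //; last by lia.
by apply/eqP; congr mget; lia.
Qed.

End Embedding.

Theorem theorem4p7
  (R : realType) (X : pseudoMetricType R) (T Tinv : X -> X)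
  (K : fieldType) (conj : {rmorphism K -> K}) (mu : set X -> R)
  (y : X) (E : nat -> set X) (P : nat -> set (set X)) :
  (* X infinite, totally disconnected, compact, metrizable *)
  hausdorff_space X -> compact [set: X] -> totally_disconnected [set: X] ->
  infinite_set [set: X] ->
  (* T homeomorphism with inverse Tinv *)
  continuous T -> continuous Tinv -> cancel T Tinv -> cancel Tinv T ->
  (* involution on K *)
  involutive conj ->
  (* mu full ergodic T-invariant Borel probability measure *)
  borel_probability mu -> full_measure mu -> invariant_measure T mu ->
  ergodic_measure T mu ->
  (* the clopen sets E_n *)
  (forall n, clopen (E n)) -> (forall n, E n.+1 `<=` E n) ->
  \bigcap_n E n = [set y] ->
  (* P_n is a partition of X \ E_n into nonempty clopen sets *)
  (forall n, finite_set (P n)) ->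
  (forall n Z, P n Z -> clopen Z /\ Z !=set0) ->
  (forall n Z Z', P n Z -> P n Z' -> Z `&` Z' !=set0 -> Z = Z') ->
  (forall n, \bigcup_(Z in P n) Z = ~` E n) ->
  (* refinement *)
  (forall n B, P n.+1 B \/ B = E n.+1 ->
     exists2 B', P n B' \/ B' = E n & B `<=` B') ->
  (* U_n (P_n u {E_n}) generates the topology of X *)
  (forall (U : set X) (x : X), open U -> U x ->
     exists (k : nat) (B : nat -> set X),
       [/\ forall i, (i < k)%N -> exists n, P n (B i) \/ B i = E n,
           forall i, (i < k)%N -> B i x
         & forall z, (forall i, (i < k)%N -> B i z) -> U z]) ->
  exists Phi : cp X K -> Rseq T K E P,
  [/\
   (* Phi maps A into R_rk *)
   forall a, inA a -> rk_cauchy mu (Phi a),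
   (* Phi is a K-algebra homomorphism A -> R_rk *)
   (forall a b, inA a -> inA b ->
      Req mu (Phi (cpadd a b)) (RRadd (Phi a) (Phi b)) /\
      Req mu (Phi (cpmul T Tinv a b)) (RRmul (Phi a) (Phi b))) /\
   (forall l a, inA a -> Req mu (Phi (cpscale l a)) (RRscale l (Phi a))) /\
   Req mu (Phi (@cpone X K)) (@RRone R X T K E P),
   (* Phi is injective *)
   forall a b, inA a -> inA b -> Req mu (Phi a) (Phi b) -> a = b,
   (* Phi restricted to A_infinity is pi_infinity *)
   forall (n : nat) (a : cp X K), inAn T Tinv conj P n a ->
     (exists x : Rn T K E P n, pi_rel Tinv conj a x) /\
     (forall x : Rn T K E P n, pi_rel Tinv conj a x -> Req mu (Phi a) (embed x))
  & [/\
   (* pi_infinity(chi_{X \ E_n} t) --> Phi(t) *)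
   forall xs : forall n, Rn T K E P n,
     (forall n, pi_rel Tinv conj (sn K E n) (xs n)) ->
     forall e : R, 0 < e -> exists N, forall n, (N <= n)%N ->
       exists M, forall m, (M <= m)%N ->
         (rkn mu (Rsub (embed (xs n) m) (Phi (cpt K) m)) < e%:E)%E,
   (* Phi(t) is invertible in R_rk *)
   exists v, [/\ rk_cauchy mu v, Req mu (RRmul (Phi (cpt K)) v) (@RRone R X T K E P)
                & Req mu (RRmul v (Phi (cpt K))) (@RRone R X T K E P)],
   (* rk_A and rk_{A_infinity} are faithful *)
   (forall a, inA a -> rk_null mu (Phi a) -> a = @cpzero X K) /\
   (forall a, inAinf T Tinv conj P a -> rk_null mu (Phi a) -> a = @cpzero X K),
   (* Phi(A_infinity) is dense in R_rk *)
   forall u, rk_cauchy mu u -> forall e : R, 0 < e ->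
     exists a, inAinf T Tinv conj P a /\
       exists M, forall m, (M <= m)%N -> (rkn mu (Rsub (Phi a m) (u m)) < e%:E)%E
  & (* hence Phi(A) is dense in R_rk *)
   forall u, rk_cauchy mu u -> forall e : R, 0 < e ->
     exists a, inA a /\
       exists M, forall m, (M <= m)%N -> (rkn mu (Rsub (Phi a m) (u m)) < e%:E)%E]].
Proof.
move=> hX cX _ infX cT cTinv TK TinvK _ mu_prob full_mu inv_mu erg_mu clE decE capE
  finP clP disjP covP refP basis.
have S : setup T Tinv mu y E P by [].
have it : inA (cpt K : cp X K) by apply: inA_mono; exact: locally_constant_cst.
have itV : inA (cpmono (fun=> 1) (-1) : cp X K).
  by apply: inA_mono; exact: locally_constant_cst.
have faithful := Phi_faithful S (K := K).
exists (Phi T y E P (K := K)); split.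
- by move=> a; exact: (Phi_cauchy S).
- split=> [a b ia ib|].
    split; last exact: (Phi_mul S).
    by apply: (Req_eventually S (n := 0%N)) => m W _ _; rewrite Phi_add.
  split=> [l a ia|].
    by apply: (Req_eventually S (n := 0%N)) => m W _ _; rewrite Phi_scale.
  by apply: (Req_eventually S (n := 0%N)) => m W _ _; rewrite Phi_one.
(* Injectivity is faithfulness applied to [a - b]. *)
- move=> a b ia ib ab; have iN : inA (cpadd a (cpscale (-1) b)).
    by apply: inA_add => //; exact: inA_scale.
  have ab0 : cpadd a (cpscale (-1) b) = @cpzero X K.
    apply: faithful => // e /ab [M hM]; exists M => m /hM.
    congr (rkn mu _ < _)%E; rewrite Phi_add Phi_scale.
    apply: functional_extensionality_dep => W.
    by rewrite /Radd /Rsub scaleN1r.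
  apply: cp_ext => k x; apply/eqP; rewrite -subr_eq0; apply/eqP.
  have := congr1 (fun c : cp X K => c k x) ab0.
  by rewrite /cpadd /cpscale /cpzero mulN1r.
- move=> n a an; have [x ax] := inAn_tower_rep S an.
  split; first by exists x; apply/(pi_relP S).
  move=> x' /(pi_relP S) ax'; apply: (Req_eventually S (n := n)) => m W nm VW.
  by rewrite (tower_rep_embed S ax' nm VW).
split.
(* At every level [m >= n] the distance is at most that of [Phi_sn_dist], so one bound on [mu (E n)]
   serves for all of them. *)
- move=> xs hxs e e0; have [N hN] := mu_E_small S e0.
  exists N => n /hN muE; exists n => m nm.
  apply: le_lt_trans (Phi_sn_dist S K nm muE).
  apply: le_esum => W VW; rewrite /Rsub.
  by rewrite (tower_rep_embed S (proj1 (pi_relP S _ _ _) (hxs n)) nm VW).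
(* The inverse is the image of the inverse of [t]. *)
- exists (Phi T y E P (cpmono (fun=> 1) (-1))); split; first exact: (Phi_cauchy S).
    have := Req_sym (Phi_mul S (cpmono (fun=> 1) (-1)) it).
    rewrite cpmul_t.
    by rewrite (_ : Phi T y E P (@cpone X K) = @RRone R X T K E P) //;
      apply: functional_extensionality_dep => m; rewrite Phi_one.
  have := Req_sym (Phi_mul S (cpt K) itV).
  rewrite cpmul_tV.
  by rewrite (_ : Phi T y E P (@cpone X K) = @RRone R X T K E P) //;
    apply: functional_extensionality_dep => m; rewrite Phi_one.
- split; first exact: faithful.
  by move=> a [n /(inAn_inA S)]; exact: faithful.
- move=> u cu e e0; have [n [a [an h]]] := Phi_dense S conj cu e0.
  by exists a; split; [exists n|exists n].
- move=> u cu e e0; have [n [a [an h]]] := Phi_dense S conj cu e0.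
  by exists a; split; [exact: (inAn_inA S an)|exists n].
Qed.
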